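(* Let $\beta>0$ and let $\mathcal{P}=\{\gamma,l^+,L,\varepsilon,C,\alpha,\xi,M\}$ be a parameter set. There exists a constant $\bar\sigma(\beta)\in(0,1)$, depending only on $\beta$ and $\mathcal{P}$ and continuous in $\beta$, such that for every $f\in\mathcal{H}(\beta,\mathcal{P})$ and every $\sigma\in(0,\bar\sigma(\beta))$ there exists a finite Gaussian mixture density $$\wp_\sigma(x)=\sum_{u=1}^{m'}p_u\,\psi_\sigma(x-\mu_u),\qquad p_u\ge 0,\ \sum_u p_u=1,$$ (all components having the same scale $\sigma$) whose number of support points $m'$ is less than $G_\beta\,\sigma^{-1}|\ln\sigma|^{3/2}$ and whose means satisfy $\mu_u\in[-\mu_\sigma,\mu_\sigma]$ with $\mu_\sigma\le \tilde G_\beta|\ln\sigma|^{1/2}$, such that $$\mathrm{KL}(f,\wp_\sigma)=\int_{\mathbb{R}}f(x)\ln\frac{f(x)}{\wp_\sigma(x)}\,dx\le c_\beta\,\sigma^{2\beta},$$ where $c_\beta>0$ is uniform over $\mathcal{H}(\beta,\mathcal{P})$ (depends only on $\beta$ and $\mathcal{P}$) and is continuous in $\beta$, and $G_\beta,\tilde G_\beta$ are positive constants depending only on $\beta$ and $\mathcal{P}$ which are increasing functions of $\beta$.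
   Context: $\psi(x)=\pi^{-1/2}e^{-x^2}$ and $\psi_\sigma(x)=\sigma^{-1}\psi(x/\sigma)$ for $\sigma>0$. For $\beta>0$, $r$ denotes the largest integer strictly less than $\beta$. A parameter set $\mathcal{P}=\{\gamma,l^+,L,\varepsilon,C,\alpha,\xi,M\}$ consists of a polynomial function $L$ on $\mathbb{R}$ and positive constants $\gamma,l^+,\varepsilon,C,\alpha,\xi,M$. The class $\mathcal{H}(\beta,\mathcal{P})$ is the set of probability densities $f$ on $\mathbb{R}$ (w.r.t. Lebesgue measure) such that: (1) (smoothness) $\ln f$ is $r$ times differentiable, for all $x,y$ with $|y-x|\le\gamma$, $|(\ln f)^{(r)}(x)-(\ln f)^{(r)}(y)|\le r!\,L(x)|y-x|^{\beta-r}$, and $|(\ln f)^{(j)}(0)|\le l^+$ for all $j\in\{0,\dots,r\}$; (2) (moments) $\int_{\mathbb{R}}|(\ln f)^{(j)}(x)|^{(2\beta+\varepsilon)/j}f(x)\,dx\le C$ for $j=1,\dots,r$ and $\int_{\mathbb{R}}|L(x)|^{2+\varepsilon/\beta}f(x)\,dx\le C$; (3) (tail) $f(x)\le M\psi(x)$ for all $x$; (4) (monotonicity) $f>0$, $f$ is nondecreasing on $(-\infty,-\alpha)$ and nonincreasing on $(\alpha,\infty)$, and $f(x)\ge\xi$ for all $x\in[-\alpha,\alpha]$. *)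

(* Defs.v *)
From HB Require Import structures.
From mathcomp Require Import all_boot all_order all_algebra.
From mathcomp Require Import all_classical all_reals all_analysis.
Set Implicit Arguments. Unset Strict Implicit. Unset Printing Implicit Defensive.
Import Order.TTheory GRing.Theory Num.Theory.
Import numFieldNormedType.Exports.
Local Open Scope classical_set_scope.
Local Open Scope ring_scope.

Section Defs.
Variable R : realType.

Definition psi (x : R) : R := (Num.sqrt pi)^-1 * expR (- x ^+ 2).

Definition psi_s (sigma x : R) : R := sigma^-1 * psi (x / sigma).

(* r = the largest integer strictly less than beta (beta > 0): r = ceil(beta) - 1 *)
Definition rdeg (beta : R) : nat := `|Num.ceil beta - 1|%N.

Definition ntimes_derivable (r : nat) (g : R -> R) : Prop :=
  forall k : nat, (k < r)%N -> forall x : R, derivable (derive1n k g) x 1.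

Definition prob_density (f : R -> R) : Prop :=
  measurable_fun setT f /\ (forall x, 0 <= f x) /\
  (\int[lebesgue_measure]_(x in setT) (f x)%:E = 1)%E.

Definition classH (beta gam lp : R) (L : {poly R}) (eps C alpha xi M : R)
    (f : R -> R) : Prop :=
  let r := rdeg beta in
  let lf := fun x => ln (f x) in
  prob_density f /\
  ntimes_derivable r lf /\
  (forall x y, `|y - x| <= gam ->
     `|derive1n r lf x - derive1n r lf y| <= (r`!)%:R * L.[x] * `|y - x| `^ (beta - r%:R)) /\
  (forall j : nat, (j <= r)%N -> `|derive1n j lf 0| <= lp) /\
  (forall j : nat, (1 <= j <= r)%N ->
     (\int[lebesgue_measure]_(x in setT)
        ((`|derive1n j lf x| `^ ((2 * beta + eps) / j%:R)) * f x)%:E <= C%:E)%E) /\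
  (\int[lebesgue_measure]_(x in setT)
        ((`|L.[x]| `^ (2 + eps / beta)) * f x)%:E <= C%:E)%E /\
  (forall x, f x <= M * psi x) /\
  (forall x, 0 < f x) /\
  (forall x y, x <= y -> y < - alpha -> f x <= f y) /\
  (forall x y, alpha < x -> x <= y -> f y <= f x) /\
  (forall x, - alpha <= x <= alpha -> xi <= f x).

Definition KL (f g : R -> R) : \bar R :=
  (\int[lebesgue_measure]_(x in setT) (f x * ln (f x / g x))%:E)%E.

Definition gmix (sigma : R) (m : nat) (p mu : 'I_m -> R) (x : R) : R :=
  \sum_(u < m) p u * psi_s sigma (x - mu u).

End Defs.

(* Main.v *)
Require Import Defs.
From HB Require Import structures.
From mathcomp Require Import all_boot all_order all_algebra.
From mathcomp Require Import all_classical all_reals all_analysis.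
From mathcomp Require Import measurable_realfun ring lra zify.
Set Implicit Arguments. Unset Strict Implicit. Unset Printing Implicit Defensive.
Import Order.TTheory GRing.Theory Num.Theory.
Import numFieldNormedType.Exports.
Local Open Scope classical_set_scope.
Local Open Scope ring_scope.

(** Since [L] is a polynomial and [f <= M psi], the smoothness condition alone bounds
    all derivatives of [ln f] by [C exp (C |x|)], uniformly over the class (the moment
    conditions are automatic).  With [a] chosen so that [\sum_i a i * p (y + i)], smoothed
    by a Gaussian, returns [p y] for every polynomial [p] of degree at most [r], put
    [w y = \sum_i a i * f (y + i sigma)] and take as unnormalised mixture the lattice sum of
    [psi_s sigma] with weights proportional to [w] on a grid of spacing of order
    [sigma / |ln sigma|] that covers [|x| <= const * sqrt |ln sigma|].  Lattice sums of
    a polynomial times a Gaussian at this spacing agree with the integrals up to a power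
    of [sigma] as large as we like, so no further discretisation of a continuous mixture is
    needed: expanding [f (x + t) / f x] to order [r] shows that the mixture is
    [f x * (1 + O (exp (C |x|) sigma ^ beta))] in the covered range, while outside it
    everything is a large power of [sigma].  Hence the integrand of the generalised
    divergence [f ln (f / g) + g - f >= 0] is [O (sigma ^ (2 beta) exp (- x ^ 2 / 16))], and
    passing from [g] to its normalisation can only lower the integral, as
    [ln Z <= Z - 1]. *)

(** * Elementary estimates *)

Section Elementary.
Variable R : realType.
Implicit Types (x y z h K b : R) (p q : {poly R}).

(** What makes the expansion usable on so wide a range is a mismatch of growth rates. With
    [v = sqrt |ln sigma|], a bound [C exp (C |x|)] taken over [|x| <= const v] costs only
    [exp (O (v))], whereas a power of the scale is [exp (- b v ^ 2)]. The relative error is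
    therefore small up to radii where [f <= M psi] is itself a high power of [sigma]. The
    coefficients [a i] may be negative, so the positivity of the weights needs an argument: their
    sum is 1, and [f] has small relative variation over shifts of order [sigma]. The error doubles
    its order because [f ln (f / g) + g - f] has no linear term in [g / f - 1]. Continuity in [beta]
    is a separate obstacle: the degree [r] jumps at integers, and the threshold for [sigma]
    deteriorates as [beta] tends to 0. All estimates are therefore uniform over [r < beta <= r + 1]
    with [beta >= b]; the resulting countable family of constants is interpolated only at the
    end. *)

Lemma expR_lin_quad (D c z : R) : 0 < c ->
  expR (D * z - c * z ^+ 2) <= expR (D ^+ 2 / (4 * c)).
Proof.
move=> c0; rewrite ler_expR -subr_ge0.
have -> : D ^+ 2 / (4 * c) - (D * z - c * z ^+ 2) =
  (2 * c * z - D) ^+ 2 / (4 * c) by field; rewrite gt_eqF.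
by rewrite divr_ge0 ?sqr_ge0// mulr_ge0// ltW.
Qed.

(** [y / (1 + |y|)] is an antiderivative of [1 / (1 + |y|) ^ 2] and stays in [[-1, 1]], so lattice
    sums telescope to a bound free of the mesh, the phase and the number of points. *)
Lemma invsq_le_diff h y : 0 < h <= 1 ->
  h / (1 + `|y|) ^+ 2 <= 2 * ((y + h) / (1 + `|y + h|) - y / (1 + `|y|)).
Proof.
move=> /andP[h0 h1].
have [y0|y0] := leP 0 y.
  have yh0 : 0 <= y + h by lra.
  rewrite !ger0_norm// -subr_ge0.
  have -> : 2 * ((y + h) / (1 + (y + h)) - y / (1 + y)) - h / (1 + y) ^+ 2 =
    h * (1 + y - h) / ((1 + y) ^+ 2 * (1 + (y + h))).
    by field; rewrite !gt_eqF//; lra.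
  by rewrite divr_ge0// mulr_ge0 ?sqr_ge0//; lra.
rewrite (ltr0_norm y0).
have [yh0|yh0] := leP 0 (y + h).
  rewrite ger0_norm//.
  have A : (y + h) / 2 <= (y + h) / (1 + (y + h)).
    by rewrite ler_wpM2l// lef_pV2 ?posrE; lra.
  have B : - y / 2 <= - (y / (1 - y)).
    by rewrite -mulNr ler_wpM2l ?lef_pV2 ?posrE; lra.
  have C : h / (1 - y) ^+ 2 <= h.
    by rewrite ler_pdivrMr ?exprn_gt0 ?ler_peMr// ?ltW//; nra.
  lra.
rewrite (ltr0_norm yh0) -subr_ge0.
have -> : 2 * ((y + h) / (1 - (y + h)) - y / (1 - y)) - h / (1 - y) ^+ 2 =
    h * (1 - y + h) / ((1 - y) ^+ 2 * (1 - (y + h))).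
  by field; rewrite !gt_eqF//; lra.
by rewrite divr_ge0// mulr_ge0 ?sqr_ge0//; lra.
Qed.

Lemma lattice_invsq_le h y (n : nat) : 0 < h <= 1 ->
  \sum_(k < n) h / (1 + `|y + k%:R * h|) ^+ 2 <= 4.
Proof.
move=> h01; set g := fun x : R => x / (1 + `|x|).
have gb x : - 1 <= g x <= 1.
  have x0 : 0 < 1 + `|x| by rewrite ltr_wpDr.
  rewrite /g ler_pdivlMr// ler_pdivrMr// !mulN1r mul1r lerNl.
  have := ler_norm x; have := ler_norm (- x); rewrite normrN; lra.
suff : \sum_(k < n) h / (1 + `|y + k%:R * h|) ^+ 2 <= 2 * (g (y + n%:R * h) - g y).
  by have := gb y; have := gb (y + n%:R * h); lra.
elim: n => [|n IH]; first by rewrite big_ord0 mul0r addr0 subrr mulr0.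
rewrite big_ord_recr/=.
have -> : y + n.+1%:R * h = y + n%:R * h + h by rewrite -addn1 natrD; ring.
have := invsq_le_diff (y + n%:R * h) h01.
rewrite -/(g (y + n%:R * h + h)) -/(g (y + n%:R * h)); lra.
Qed.

(** The 4 is the bound for the sums of [h / (1 + |z|) ^ 2]; the exponent bounds
    [(D + 2) |z| - z ^ 2 / 2], two units of slope being spent on [(1 + |z|) ^ 2 <= exp (2 |z|)]. *)
Definition sumC (D : R) : R := 4 * expR ((D + 2) ^+ 2 / 2).

Lemma sumC_gt0 D : 0 < sumC D. Proof. by rewrite mulr_gt0// expR_gt0. Qed.

Lemma lattice_gauss_le D h y (n : nat) : 0 < h <= 1 ->
  \sum_(k < n) h * expR (D * `|y + k%:R * h| - (y + k%:R * h) ^+ 2 / 2) <= sumC D.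
Proof.
move=> h01; have h0 : 0 <= h by lra.
apply: (@le_trans _ _ (\sum_(k < n) expR ((D + 2) ^+ 2 / 2) *
    (h / (1 + `|y + k%:R * h|) ^+ 2))); last first.
  by rewrite -mulr_sumr /sumC mulrC ler_wpM2r ?expR_ge0 ?lattice_invsq_le.
apply: ler_sum => k _; set z := y + _.
have z1 : 0 < 1 + `|z| by rewrite ltr_wpDr.
rewrite mulrCA ler_wpM2l// ler_pdivlMr ?exprn_gt0//.
apply: (@le_trans _ _ (expR (D * `|z| - z ^+ 2 / 2) * expR (2 * `|z|))).
  rewrite ler_wpM2l ?expR_ge0// expRM_natl lerXn2r ?nnegrE ?expR_ge0 ?(ltW z1)//.
  exact: expR_ge1Dx.
rewrite -expRD; have h2 : 0 < 2^-1 :> R by rewrite invr_gt0.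
have := @expR_lin_quad (D + 2) 2^-1 `|z| h2.
rewrite real_normK ?num_real//.
have -> : 4 * 2^-1 = 2 :> R by lra.
by apply: le_trans; rewrite ler_expR; lra.
Qed.

Lemma gauss_beats_exp K b eta : 0 <= K -> 0 < b -> 0 < eta ->
  exists2 v0 : R, 1 <= v0 & forall v, v0 <= v ->
    K * expR (K * v) * expR (- b * v ^+ 2) <= eta.
Proof.
(* From here on the total exponent is at most [- (K / eta)], and [exp (K / eta) >= K / eta]. *)
move=> K0 b0 e0; exists (1 + (K + K / eta) / b).
  by rewrite lerDl divr_ge0 ?addr_ge0 ?divr_ge0// ltW.
move=> v; set w := _ / b => v0.
have w0 : 0 <= w by rewrite divr_ge0 ?addr_ge0 ?divr_ge0// ltW.
have Ke : 0 <= K / eta by rewrite divr_ge0// ltW.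
have bw : b * w = K + K / eta by rewrite /w mulrC divfK ?gt_eqF.
rewrite -mulrA -expRD.
have H : K * v + - b * v ^+ 2 <= - (K / eta).
  have : K * v + K / eta <= b * w * v by rewrite bw; nra.
  have : b * w * v <= b * v * v by rewrite ler_wpM2r ?ler_pM2l//; lra.
  lra.
apply: (@le_trans _ _ (K * expR (- (K / eta)))).
  by rewrite ler_wpM2l// ler_expR.
rewrite expRN ler_pdivrMr ?expR_gt0//.
apply: (@le_trans _ _ (eta * (K / eta))); first by rewrite mulrC divfK ?gt_eqF.
rewrite ler_wpM2l ?(ltW e0)//.
by apply: le_trans (expR_ge1Dx _); lra.
Qed.

Lemma mvt_le (f df : R -> R) (a b : R) : (forall x, is_derive x 1 f (df x)) ->
  a <= b -> exists2 c, a <= c <= b & f b - f a = df c * (b - a).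
Proof.
move=> fd ab; have [//|] := @MVT_segment R f df a b ab (fun x _ => fd x).
  apply: continuous_subspaceT => x.
  by apply: differentiable_continuous; apply/derivable1_diffP; case: (fd x).
by move=> c; rewrite in_itv/= => cab ->; exists c.
Qed.

Lemma mvt_norm_le (f df : R -> R) (a b A : R) : (forall x, is_derive x 1 f (df x)) ->
  (forall x, (a <= x <= b) || (b <= x <= a) -> `|df x| <= A) ->
  `|f b - f a| <= A * `|b - a|.
Proof.
move=> fd dA; have [ab|/ltW ba] := leP a b.
  have [c cab ->] := mvt_le fd ab.
  by rewrite normrM ler_wpM2r// dA// cab.
have [c cab E] := mvt_le fd ba.
by rewrite distrC E normrM (distrC a) ler_wpM2r// dA// cab orbT.
Qed.

End Elementary.

(** * Lattice sums of polynomials against a Gaussian *)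

Section Trapezoid.
Variable R : realType.
Implicit Types (x y z h s : R) (p q : {poly R}).

(** Differentiation conjugated by [exp (- z ^ 2)]. A polynomial in the range of [gop] has zero
    integral against the Gaussian. *)
Definition gop p : {poly R} := p^`() - ('X * p) *+ 2.

Lemma gopD p q : gop (p + q) = gop p + gop q.
Proof. by rewrite /gop derivD mulrDr mulrnDl opprD; ring. Qed.

Lemma gopZ (c : R) p : gop (c *: p) = c *: gop p.
Proof. by rewrite /gop derivZ scalerBr -scalerMnr -scalerAr. Qed.

Lemma gop0 : gop 0 = 0.
Proof. by rewrite /gop deriv0 mulr0 mul0rn subrr. Qed.

Lemma is_derive_gauss_poly p x :
  is_derive x 1 (fun z => p.[z] * gauss_fun z) ((gop p).[x] * gauss_fun x).
Proof.
have D1 := is_derive_poly p x.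
have D2 : is_derive x 1 (fun z : R => - z ^+ 2) (- (2 * x)).
  apply: is_derive_eq; rewrite /GRing.scale/=.
  by ring.
have D3 := @is_derive1_comp R expR (fun z : R => - z ^+ 2) x _ _
  (is_derive_expR (- x ^+ 2)) D2.
apply: (is_derive_eq (is_deriveM D1 D3)).
rewrite /GRing.scale/= /gauss_fun /gop hornerD hornerN hornerMn hornerM hornerX.
by rewrite -mulr_natr; ring.
Qed.

(** The weight [s ^ i] balances the two halves of [gop]: multiplication by ['X] costs a factor [s],
    differentiation at most [n / s]. *)
Definition wnorm s n p : R := \sum_(i < n) `|p`_i| * s ^+ i.

Lemma wnorm_ge0 s n p : 0 <= s -> 0 <= wnorm s n p.
Proof. by move=> s0; apply: sumr_ge0 => i _; rewrite mulr_ge0 ?exprn_ge0. Qed.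

Lemma wnorm_le s n p : 1 <= s -> wnorm s n p <= wnorm 1 n p * s ^+ n.
Proof.
move=> s1; rewrite /wnorm mulr_suml ler_sum// => i _.
by rewrite expr1n mulr1 ler_wpM2l// ler_weXn2l// ltnW.
Qed.

(** With [u = |z| / s], [u ^ i <= exp (i u ^ 2 / 2) <= exp (z ^ 2 / 2)]. Half of the Gaussian
    exponent thus pays for the polynomial, and the other half remains for summing over the
    lattice. *)
Lemma horner_wnorm s n p z : 0 < s -> (size p <= n)%N -> n%:R <= s ^+ 2 ->
  `|p.[z]| <= wnorm s n p * expR (z ^+ 2 / 2).
Proof.
move=> s0 pn ns; rewrite (horner_coef_wide _ pn).
apply: le_trans (ler_norm_sum _ _ _) _; rewrite /wnorm mulr_suml ler_sum// => i _.
rewrite normrM -mulrA ler_wpM2l// normrX.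
have -> : `|z| ^+ i = s ^+ i * (`|z| / s) ^+ i by rewrite -exprMn mulrC divfK ?gt_eqF.
rewrite ler_wpM2l ?exprn_ge0 ?(ltW s0)//.
set u := `|z| / s; have u0 : 0 <= u by rewrite divr_ge0// ltW.
apply: (@le_trans _ _ (expR (u ^+ 2 / 2) ^+ i)).
  rewrite lerXn2r ?nnegrE ?expR_ge0//.
  by apply: le_trans (expR_ge1Dx _); have := sqr_ge0 (u - 1); lra.
rewrite -expRM_natl ler_expR mulrA ler_wpM2r//.
rewrite /u expr_div_n real_normK ?num_real// mulrA ler_pdivrMr ?exprn_gt0//.
rewrite mulrC ler_wpM2l ?sqr_ge0//.
by apply: le_trans ns; rewrite ler_nat ltnW.
Qed.

Lemma size_gop n p : (size p <= n)%N -> (size (gop p) <= n.+1)%N.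
Proof.
move=> pn; apply: (leq_trans (size_polyD _ _)); rewrite geq_max; apply/andP; split.
  apply: (leq_trans (size_poly _ _)); lia.
rewrite size_polyN -mulr_natr -polyC_natr mulrC mul_polyC.
apply: leq_trans (size_scale_leq _ _) _.
apply: leq_trans (size_polyMleq _ _) _; rewrite size_polyX.
by change (2%R : nat) with 2%N; rewrite add2n; exact: leq_trans pn _.
Qed.

Lemma wnorm_gop s n p : 0 < s -> (size p <= n)%N ->
  wnorm s n.+1 (gop p) <= (n%:R / s + 2 * s) * wnorm s n p.
Proof.
move=> s0 pn.
apply: (@le_trans _ _ (wnorm s n.+1 p^`() + 2 * wnorm s n.+1 ('X * p))).
  rewrite /wnorm mulr_sumr -big_split/= ler_sum// => i _.
  rewrite /gop coefB coefMn mulrA -mulrDl ler_wpM2r ?exprn_ge0 ?(ltW s0)//.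
  by apply: le_trans (ler_normB _ _) _; rewrite normrMn mulr_natl.
rewrite [X in _ <= X]mulrDl. apply: lerD.
  have dn : p`_n = 0 by rewrite nth_default.
  rewrite /wnorm big_ord_recr/= coef_deriv nth_default ?(leq_trans pn)//.
  rewrite mul0rn normr0 mul0r addr0.
  case: n pn dn => [|n] pn dn; first by rewrite !big_ord0 mulr0.
  rewrite big_ord_recr/= coef_deriv dn mul0rn normr0 mul0r addr0.
  rewrite [X in _ <= _ * X]big_ord_recl mulrDr ler_wpDl//.
    by rewrite !mulr_ge0 ?invr_ge0 ?exprn_ge0 ?(ltW s0).
  rewrite mulr_sumr ler_sum// => i _; rewrite coef_deriv lift0 exprS.
  rewrite normrMn -[_ *+ i.+1]mulr_natr.
  have -> : n.+1%:R / s * (`|p`_i.+1| * (s * s ^+ i)) =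
    `|p`_i.+1| * n.+1%:R * s ^+ i.
    by rewrite [LHS]mulrA -mulrA; field; rewrite gt_eqF.
  rewrite ler_wpM2r ?exprn_ge0 ?(ltW s0)// ler_wpM2l// ler_nat; exact: leqW (ltn_ord i).
rewrite -mulrA ler_wpM2l// /wnorm big_ord_recl coefXM/= normr0 mul0r add0r mulr_sumr.
apply: ler_sum => i _; rewrite coefXM/= exprS.
by lra.
Qed.

(** Sizes stay below [17 s], so each [gop] costs at most [17 + 2 s <= 4 s]. Against the mesh
    [1 / (16 s)] this leaves a factor 1/4 per derivative. *)
Lemma iter_gop_bound (s n j : nat) p : (17 <= s)%N -> (n <= s)%N -> (size p <= n)%N ->
  (j <= 16 * s)%N -> forall z,
  `|(iter j gop p).[z] * gauss_fun z| <=
    (4 * s%:R) ^+ j * (wnorm 1 n p * s%:R ^+ n) * expR (- (z ^+ 2 / 2)).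
Proof.
move=> s17 ns pn js z.
have s0 : 0 < s%:R :> R by rewrite ltr0n; lia.
have s17' : 17 <= s%:R :> R by rewrite (ler_nat R 17).
have A : (size (iter j gop p) <= n + j)%N /\
    wnorm s%:R (n + j) (iter j gop p) <= (4 * s%:R) ^+ j * wnorm s%:R n p.
  elim: j js => [|j IH] js; first by rewrite addn0 expr0 mul1r.
  have [IH1 IH2] := IH (ltnW js); split.
    by rewrite addnS iterS; exact: size_gop.
  rewrite addnS iterS; apply: le_trans (wnorm_gop s0 IH1) _.
  rewrite exprS -mulrA; apply: ler_pM => //.
  - by apply: wnorm_ge0; exact: ltW.
  suff : (n + j)%:R / s%:R <= 17 :> R by lra.
    by rewrite ler_pdivrMr// -(natrM _ 17) ler_nat; lia.
have [A1 A2] := A.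
rewrite normrM (ger0_norm (expR_ge0 _)) /gauss_fun.
have -> : - z ^+ 2 = - (z ^+ 2 / 2) + - (z ^+ 2 / 2) by lra.
rewrite expRD [leLHS]mulrA ler_wpM2r ?expR_ge0//.
rewrite expRN ler_pdivrMr ?expR_gt0//.
have nj : (n + j)%:R <= s%:R ^+ 2 :> R by rewrite -natrX ler_nat; nia.
apply: le_trans (horner_wnorm z s0 A1 nj) _.
rewrite ler_wpM2r ?expR_ge0//; apply: le_trans A2 _.
rewrite ler_wpM2l ?exprn_ge0 ?mulr_ge0 ?(ltW s0)//.
by apply: wnorm_le; lra.
Qed.

Lemma is_derive_sum_ord (n : nat) (F dF : nat -> R -> R) x :
  (forall k, is_derive x 1 (F k) (dF k x)) ->
  is_derive x 1 (fun y => \sum_(k < n) F k y) (\sum_(k < n) dF k x).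
Proof.
move=> Fd; elim: n => [|n IH].
  rewrite big_ord0; under [X in is_derive _ _ X _]eq_fun do rewrite big_ord0.
  exact: is_derive_cst.
rewrite big_ord_recr/=; under [X in is_derive _ _ X _]eq_fun do rewrite big_ord_recr/=.
exact: is_deriveD.
Qed.

Definition gsum h (n : nat) p y : R :=
  \sum_(k < n) h * (p.[y + k%:R * h] * gauss_fun (y + k%:R * h)).

Lemma gsumD h n p q y : gsum h n (p + q) y = gsum h n p y + gsum h n q y.
Proof.
by rewrite /gsum -big_split/=; apply: eq_bigr => k _; rewrite hornerD mulrDl mulrDr.
Qed.

Lemma gsumZ h n c p y : gsum h n (c *: p) y = c * gsum h n p y.
Proof.
by rewrite /gsum mulr_sumr; apply: eq_bigr => k _; rewrite hornerZ; ring.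
Qed.

Lemma is_derive_gsum h n p x : is_derive x 1 (gsum h n p) (gsum h n (gop p) x).
Proof.
apply: (@is_derive_sum_ord n (fun k y => h * (p.[y + k%:R * h] * gauss_fun (y + k%:R * h)))
  (fun k y => h * ((gop p).[y + k%:R * h] * gauss_fun (y + k%:R * h)))) => k.
have D1 : is_derive x 1 (fun y : R => y + k%:R * h) 1.
  by apply: is_derive_eq; rewrite addr0.
have D2 := @is_derive1_comp R (fun z => p.[z] * gauss_fun z)
  (fun y => y + k%:R * h) x _ _ (is_derive_gauss_poly p (x + k%:R * h)) D1.
have := is_deriveZ h D2.
by rewrite /GRing.scale/= mulr1.
Qed.

Lemma gsum_shift h n p y :
  gsum h n p (y + h) - gsum h n p y =
  h * (p.[y + n%:R * h] * gauss_fun (y + n%:R * h) - p.[y] * gauss_fun y).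
Proof.
elim: n => [|n IH]; first by rewrite /gsum !big_ord0 mul0r addr0 !subrr mulr0.
rewrite /gsum !big_ord_recr/= -!/(gsum _ _ _ _).
have -> : y + n.+1%:R * h = y + h + n%:R * h by rewrite -addn1 natrD; ring.
by move/(congr1 (fun u => u + gsum h n p y)): IH; rewrite subrK => ->; ring.
Qed.

Lemma expr_le_fact (n : nat) x : 0 <= x -> x ^+ n <= n`!%:R * expR x.
Proof.
move=> x0; case: n => [|n].
  by rewrite expr0 fact0 mul1r -expR0 ler_expR.
rewrite mulrC -ler_pdivrMr ?ltr0n ?fact_gt0//.
by apply: le_trans (expR_ge1Dxn n x0); rewrite lerDr.
Qed.

Lemma expR1_le4 : expR 1 <= 4 :> R.
Proof.
have e2 : expR (2^-1) <= 2 :> R.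
  rewrite -[2^-1]opprK expRN -[leRHS]invrK lef_pV2 ?posrE ?expR_gt0 ?invr_gt0//.
  by apply: le_trans (expR_ge1Dx _); lra.
have -> : 1 = 2^-1 + 2^-1 :> R by lra.
by rewrite expRD; have := expR_ge0 (2^-1 : R); nra.
Qed.

(* Up to boundary terms a lattice sum is periodic in its phase, so each of its phase
   derivatives vanishes approximately somewhere in a period; iterating the mean value
   theorem 16 s times against the derivative bounds of the Gaussian gains 4^(-16 s). *)
Lemma trapezoid q : exists C : R, exists s0 : nat, 0 <= C /\
  forall (s n : nat) y, (s0 <= s)%N -> y <= - (16 * s%:R) ->
    16 * s%:R <= y + n%:R * (16 * s%:R)^-1 ->
  `|gsum (16 * s%:R)^-1 n (gop q) y| <= C * expR (- s%:R).
Proof.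
set d := size q.
exists ((4 * sumC 0 + 4) * 4 * wnorm 1 d q * d.+1`!%:R), (maxn 17 d); split.
  rewrite !mulr_ge0 ?wnorm_ge0 ?ler0n// addr_ge0// mulr_ge0// ltW//.
  exact: sumC_gt0.
move=> s n y0; rewrite geq_max => /andP[s17 ds] ylo yhi.
set h := (16 * s%:R)^-1.
have s1 : 1 <= s%:R :> R by rewrite (ler_nat R 1); lia.
have h0 : 0 < h by rewrite invr_gt0; lra.
have h1 : h <= 1 by rewrite /h invf_le1; lra.
have h01 : 0 < h <= 1 by rewrite h0.
have hs : h * (16 * s%:R) = 1 by rewrite mulVf// gt_eqF//; lra.
set W := wnorm 1 d q * s%:R ^+ d.
have W0 : 0 <= W by rewrite mulr_ge0 ?wnorm_ge0 ?exprn_ge0.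
pose U (j : nat) := (4 * s%:R) ^+ j * W.
have U0 j : 0 <= U j by rewrite mulr_ge0 ?exprn_ge0//; lra.
have US j : U j.+1 = 4 * s%:R * U j by rewrite /U exprS; ring.
pose e : R := expR (- (16 * s%:R)).
have e0 : 0 <= e by exact: expR_ge0.
have bd j z : (j <= 16 * s)%N -> 16 * s%:R <= `|z| ->
    `|(iter j gop q).[z] * gauss_fun z| <= U j * e.
  move=> js zs; apply: le_trans (iter_gop_bound s17 ds (leqnn _) js z) _.
  rewrite -/W -/(U j); apply: ler_wpM2l => //; rewrite ler_expR lerN2 -(real_normK (num_real z)).
  by rewrite ler_pdivlMr//; nra.
pose S j := gsum h n (iter j gop q).
have dS j x : is_derive x 1 (S j) (S j.+1 x) by exact: is_derive_gsum.
have top x : `|S (16 * s)%N x| <= U (16 * s)%N * sumC 0.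
  apply: le_trans (ler_norm_sum _ _ _) _.
  apply: le_trans (ler_wpM2l (U0 _) (lattice_gauss_le 0 x n h01)).
  rewrite mulr_sumr ler_sum// => k _; rewrite normrM gtr0_norm// mulrCA ler_wpM2l ?(ltW h0)//.
  by rewrite mul0r add0r; exact: iter_gop_bound.
(* Descent in the order of the derivative, stopping at order 1, the sum for [gop q] itself. The
   boundary allowance [4 e] is stable, as [2 e + 4 e / 4 <= 4 e]. *)
have H i : (i < 16 * s)%N -> forall x, y0 <= x <= y0 + h ->
    `|S (16 * s - i)%N x| <= U (16 * s - i)%N * (sumC 0 * 4^-1 ^+ i + 4 * e).
  elim: i => [|i IH] iS x xy.
    rewrite subn0 expr0 mulr1; apply: le_trans (top x) _.
    by rewrite ler_wpM2l// lerDl mulr_ge0.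
  set j := (16 * s - i.+1)%N.
  have jE : (16 * s - i = j.+1)%N by rewrite /j; clear -iS; lia.
  have j0 : (0 < j)%N by rewrite subn_gt0.
  have js : (j <= 16 * s)%N by exact: leq_subr.
  move: (IH (ltnW iS)); rewrite jE => {}IH.
  have y0h : y0 <= y0 + h by rewrite lerDl ltW.
  have [c cy] := mvt_le (dS j.-1) y0h.
  rewrite prednK// gsum_shift [y0 + h - y0]addrAC subrr add0r [RHS]mulrC.
  move=> /(mulfI (lt0r_neq0 h0)) cE.
  have cb : `|S j c| <= 2 * (U j * e).
    rewrite -cE; apply: le_trans (ler_normB _ _) _.
    have j1 : (j.-1 <= 16 * s)%N by exact: leq_trans (leq_pred _) js.
    have Uj : U j.-1 * e <= U j * e.
      rewrite ler_wpM2r// -(prednK j0) US; have := U0 j.-1; nra.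
    have A1 : 16 * s%:R <= `|y0| by rewrite -normrN ler_normr; apply/orP; left; lra.
    have A2 : 16 * s%:R <= `|y0 + n%:R * h| by rewrite ler_normr yhi.
    have := bd _ _ j1 A1; have := bd _ _ j1 A2; lra.
  have diff : `|S j x - S j c| <= U j.+1 * (sumC 0 * 4^-1 ^+ i + 4 * e) * h.
    apply: (@le_trans _ _ (U j.+1 * (sumC 0 * 4^-1 ^+ i + 4 * e) * `|x - c|)).
      apply: (mvt_norm_le (dS j)) => t /orP ct; apply: IH.
      by move/andP: xy => [? ?]; move/andP: cy => [? ?]; case: ct => /andP[? ?]; apply/andP; lra.
    rewrite ler_wpM2l//.
      by rewrite mulr_ge0// addr_ge0 ?mulr_ge0 ?exprn_ge0// ltW// sumC_gt0.
    by rewrite ler_norml; move/andP: xy => [? ?]; move/andP: cy => [? ?]; lra.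
  have Uh : U j.+1 * h = U j / 4.
    rewrite US; have -> : 4 * s%:R * U j * h = (h * (16 * s%:R)) * U j / 4 by lra.
    by rewrite hs mul1r.
  rewrite mulrAC Uh in diff.
  have -> : S j x = S j c + (S j x - S j c) by lra.
  apply: le_trans (ler_normD _ _) _; rewrite exprS.
  by have := mulr_ge0 (U0 j) e0; lra.
have s16 : (0 < 16 * s)%N by lia.
have p16 : ((16 * s).-1 < 16 * s)%N by lia.
have y0h : y0 <= y0 <= y0 + h by rewrite lexx lerDl ltW.
have := H _ p16 y0 y0h.
have -> : (16 * s - (16 * s).-1 = 1)%N by clear -s16; lia.
have -> : 4^-1 ^+ (16 * s).-1 = 4 * 4^-1 ^+ (16 * s) :> R.
  by rewrite -[in RHS](prednK s16) exprS mulrA mulfV ?mul1r.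
move=> /le_trans; apply.
have q4 : 4^-1 ^+ (16 * s) <= e.
  rewrite /e -[16 * s%:R]mulr1 -(natrM _ 16) -mulrN expRM_natl lerXn2r ?nnegrE ?expR_ge0//.
  by rewrite expRN lef_pV2 ?posrE ?expR_gt0// expR1_le4.
have sd := expr_le_fact d.+1 (ltW (lt_le_trans ltr01 s1)).
apply: (@le_trans _ _ (4 * (wnorm 1 d q) * (4 * sumC 0 + 4) * (s%:R ^+ d.+1 * e))).
  rewrite /U expr1 /W exprS.
  have -> : 4 * wnorm 1 d q * (4 * sumC 0 + 4) * (s%:R * s%:R ^+ d * e) =
    4 * s%:R * (wnorm 1 d q * s%:R ^+ d) * (4 * sumC 0 * e + 4 * e) by ring.
  rewrite ler_wpM2l//.
    by rewrite !mulr_ge0 ?wnorm_ge0 ?exprn_ge0.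
  by rewrite lerD2r; have := sumC_gt0 (0 : R); nra.
have -> : (4 * sumC 0 + 4) * 4 * wnorm 1 d q * d.+1`!%:R * expR (- s%:R) =
  4 * wnorm 1 d q * (4 * sumC 0 + 4) * (d.+1`!%:R * expR (- s%:R)) by ring.
rewrite ler_wpM2l//.
  by rewrite !mulr_ge0 ?wnorm_ge0// addr_ge0// mulr_ge0// ltW// sumC_gt0.
apply: le_trans (ler_wpM2r e0 sd) _.
rewrite -mulrA ler_wpM2l// -expRD ler_expR; lra.
Qed.

End Trapezoid.

(** * Inverting Gaussian smoothing on polynomials *)

Section Stencil.
Variable R : realType.
Implicit Types (c : R) (p q : {poly R}).

(** Says that [c] is the mean of [p] under the density [psi], in the form of a certificate: the
    antiderivative [q] is exactly the input of [trapezoid]. *)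
Definition gmean p c := exists q, p = gop q + c%:P.

Lemma gmeanD p1 c1 p2 c2 : gmean p1 c1 -> gmean p2 c2 -> gmean (p1 + p2) (c1 + c2).
Proof.
by move=> [q1 ->] [q2 ->]; exists (q1 + q2); rewrite gopD polyCD; ring.
Qed.

Lemma gmeanZ b p c : gmean p c -> gmean (b *: p) (b * c).
Proof.
by move=> [q ->]; exists (b *: q); rewrite gopZ scalerDr polyCM mul_polyC.
Qed.

Lemma gmean_sum (n : nat) (p : nat -> {poly R}) (c : nat -> R) :
  (forall i, (i < n)%N -> gmean (p i) (c i)) -> gmean (\sum_(i < n) p i) (\sum_(i < n) c i).
Proof.
elim: n => [|n IH] H.
  by rewrite !big_ord0; exists 0; rewrite gop0 addr0.
rewrite !big_ord_recr/=; apply: gmeanD; last exact: H.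
by apply: IH => i ni; apply: H; exact: ltnW.
Qed.

(** Moments of the centred normal law of variance 1/2, whose density is [psi]. *)
Fixpoint gmoment (j : nat) : R :=
  match j with 0 => 1 | 1 => 0 | (j'.+1 as i).+1 => j'.+1%:R / 2 * gmoment j' end.

Lemma gmean_Xn j : gmean 'X^j (gmoment j).
Proof.
elim/ltn_ind: j => -[_|[_|j IH]].
- by exists 0; rewrite gop0 add0r.
- exists ((- 2^-1)%:P); rewrite /gop derivC /= polyC0 addr0 sub0r expr1.
  rewrite -mulr_natr -polyC_natr -mulrA -polyCM.
  have -> : - 2^-1 * 2%:R = -1 :> R by lra.
  by rewrite polyCN polyC1 mulrN1 opprK.
- have [q E] := gmeanZ (j.+1%:R / 2) (IH j (leqnSn j.+1)).
  have G : gop ('X^(j.+1)) = j.+1%:R *: 'X^j - 2%:R *: 'X^(j.+2) :> {poly R}.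
    by rewrite /gop derivXn -exprS !scaler_nat.
  exists (q - 2^-1 *: 'X^(j.+1)); rewrite gopD -scaleNr gopZ G scalerBr !scalerA.
  have -> : gop q = (j.+1%:R / 2) *: 'X^j - (j.+1%:R / 2 * gmoment j)%:P by rewrite E addrK.
  have -> : - 2^-1 * j.+1%:R = - (j.+1%:R / 2) :> R by lra.
  have -> : - 2^-1 * 2%:R = -1 :> R by lra.
  by rewrite /= scaleN1r scaleNr; ring.
Qed.

(** [v] inverts the moment sequence for binomial convolution: it lists the moments of a signed
    measure that would undo the Gaussian. The system is triangular with diagonal [gmoment 0 = 1]. *)
Lemma inverse_moments r : exists v : nat -> R, forall j, (j <= r)%N ->
  \sum_(l < j.+1) 'C(j, l)%:R * v l * gmoment (j - l) = (j == 0%N)%:R.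
Proof.
elim: r => [|r [v vE]].
  exists (fun=> 1) => -[|//] _.
  by rewrite big_ord1 bin0 subnn !mulr1.
exists (fun l => if (l <= r)%N then v l else
  - \sum_(l < r.+1) 'C(r.+1, l)%:R * v l * gmoment (r.+1 - l)) => j.
rewrite leq_eqVlt => /predU1P[->|jr].
  rewrite big_ord_recr/= ltnn binn subnn mul1r mulr1.
  apply/eqP; rewrite subr_eq0; apply/eqP; apply: eq_bigr => l _.
  by rewrite -ltnS ltn_ord.
rewrite -[RHS]vE//; apply: eq_bigr => l _.
have lr : (l <= r)%N by rewrite -ltnS; exact: leq_trans (ltn_ord l) jr.
by rewrite lr.
Qed.

(** The nodes [0, ..., r] are distinct, so a signed measure on them can have any prescribed moments
    up to order [r]. *)
Lemma vandermonde_solve r (v : nat -> R) : exists a : 'I_r.+1 -> R,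
  forall l, (l <= r)%N -> \sum_i a i * i%:R ^+ l = v l.
Proof.
pose V := Vandermonde r.+1 (\row_(i < r.+1) (i%:R : R)).
have Vu : V \in unitmx.
  rewrite unitmxE det_Vandermonde unitfE.
  apply/prodf_neq0 => i _; apply/prodf_neq0 => j ij.
  by rewrite !mxE subr_eq0 eqr_nat gtn_eqF.
pose b := invmx V *m (\col_(l < r.+1) v l).
exists (fun i => b i 0) => l lr.
have : (V *m b) (inord l) 0 = v l by rewrite mulKVmx// mxE inordK.
move=> <-; rewrite mxE; apply: eq_bigr => i _.
by rewrite mulrC !mxE inordK.
Qed.

(* Sampling at the shifts 0, ..., r undoes Gaussian smoothing on polynomials of
   degree at most r. *)
Lemma stencil r : exists a : 'I_r.+1 -> R, \sum_i a i = 1 /\ forall j, (j <= r)%N ->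
  gmean (\sum_i a i *: ('X + (i%:R)%:P) ^+ j) (j == 0%N)%:R.
Proof.
have [v vE] := inverse_moments r; have [a aE] := vandermonde_solve r v.
exists a; split.
  have v01 : v 0%N = 1.
    by have := vE 0%N isT; rewrite big_ord1 bin0 subnn mul1r mulr1 eqxx.
  by rewrite -[RHS]v01 -aE//; apply: eq_bigr => i _; rewrite expr0 mulr1.
move=> j jr; rewrite -vE//.
have -> : \sum_i a i *: ('X + (i%:R)%:P) ^+ j =
    \sum_(l < j.+1) ('C(j, l)%:R * v l) *: 'X^(j - l).
  under eq_bigr do rewrite exprDn scaler_sumr.
  rewrite exchange_big/=; apply: eq_bigr => l _.
  have lr : (l <= r)%N by apply: leq_trans jr; rewrite -ltnS.
  rewrite -aE// mulr_sumr scaler_suml; apply: eq_bigr => i _.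
  rewrite -rmorphXn/= mulrC mul_polyC -scaler_nat !scalerA.
  by congr (_ *: _); ring.
apply: (@gmean_sum _ (fun l => ('C(j, l)%:R * v l) *: 'X^(j - l))
  (fun l => 'C(j, l)%:R * v l * gmoment (j - l))) => l _.
exact/gmeanZ/gmean_Xn.
Qed.

End Stencil.

(** * Continuous increasing majorants *)

Section Envelope.
Variable R : realType.
Implicit Types (u : nat -> R) (x y b : R).

Definition ramp x : R := (x + `|x|) / 2.

(** Term [n] vanishes up to [b = n - 1] and is at least [u n] from [b = n] on, so locally only
    finitely many terms act. The leading [b] makes the sum strictly increasing. *)
Definition envsum u (N : nat) b : R := b + \sum_(n < N) u n * ramp (b - n%:R + 1).

Lemma ramp_ge0 x : 0 <= ramp x.
Proof. by rewrite /ramp; have := ler_norm (- x); rewrite normrN; lra. Qed.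

Lemma ramp_le0 x : x <= 0 -> ramp x = 0.
Proof. by move=> x0; rewrite /ramp ler0_norm// addrN mul0r. Qed.

Lemma ramp_ge x : x <= ramp x.
Proof. by rewrite /ramp; have := ler_norm x; lra. Qed.

Lemma le_ramp x y : x <= y -> ramp x <= ramp y.
Proof.
move=> xy; rewrite /ramp ler_wpM2r ?invr_ge0//.
by have [?|?] := ger0P x; have [?|?] := ger0P y; lra.
Qed.

Lemma continuous_envsum u N : continuous (envsum u N).
Proof.
move=> x; apply: cvgD; first exact: cvg_id.
elim: N => [|N IH].
  by under eq_cvg do rewrite big_ord0; rewrite big_ord0; exact: cvg_cst.
under eq_cvg do rewrite big_ord_recr; rewrite big_ord_recr/=; apply: cvgD => //.
apply: cvgM; first exact: cvg_cst.
have c : (y - N%:R + 1) @[y --> x] --> (x - N%:R + 1).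
  by apply: cvgD; [apply: cvgB; [exact: cvg_id|exact: cvg_cst]|exact: cvg_cst].
apply: cvgM; last exact: cvg_cst.
by apply: cvgD => //; exact: cvg_norm.
Qed.

Definition envelope u b : R := envsum u (Num.trunc b).+2 b.

Lemma envsum_stable u (N N' : nat) b : (N <= N')%N -> b + 1 <= N%:R ->
  envsum u N' b = envsum u N b.
Proof.
move=> NN' bN; rewrite /envsum; congr (_ + _).
rewrite -(subnKC NN') big_split_ord/= [X in _ + X]big1 ?addr0// => i _.
rewrite ramp_le0 ?mulr0//.
have : N%:R <= (N + i)%:R :> R by rewrite ler_nat leq_addr.
lra.
Qed.

Lemma envelopeE u (N : nat) b : 0 < b -> b + 1 <= N%:R -> envelope u b = envsum u N b.
Proof.
move=> b0 bN; rewrite /envelope.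
have t1 : b + 1 <= (Num.trunc b).+2%:R.
  have /andP[_] := truncn_itv (ltW b0).
  by move=> /ltW; rewrite -[(Num.trunc b).+2]addn1 natrD lerD2r.
have [?|/ltnW ?] := leqP N (Num.trunc b).+2; first exact: envsum_stable.
by symmetry; exact: envsum_stable.
Qed.

Lemma envelope_continuous u b : 0 < b -> {for b, continuous (envelope u)}.
Proof.
(* One index beyond the cut-off at [b], so that the same [N] serves every [y < b + 1]. *)
move=> b0; set N := (Num.trunc b).+3.
have bN : b + 2 <= N%:R.
  have /andP[_ /ltW] := truncn_itv (ltW b0).
  by rewrite /N -[(Num.trunc b).+3]addn2 natrD lerD2r.
have bb1 : b < b + 1 by lra.
have Eb : envelope u b = envsum u N b by apply: envelopeE => //; lra.
rewrite /prop_for /continuous_at Eb.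
apply: cvg_trans (@continuous_envsum u N b).
apply: near_eq_cvg; near=> y; rewrite (@envelopeE u N y)//; last first.
  have : y < b + 1 by near: y; exact: lt_nbhsl.
  lra.
by near: y; exact: lt_nbhsr.
Unshelve. all: by end_near. Qed.

Lemma envelope_ge u b (n : nat) : (forall n, 0 <= u n) -> 0 < b -> n%:R <= b ->
  u n <= envelope u b.
Proof.
move=> u0 b0 nb; rewrite /envelope /envsum.
have nN : (n < (Num.trunc b).+2)%N.
  by rewrite ltnS leqW// truncn_ge_nat// ltW.
rewrite (bigD1 (Ordinal nN))//=.
have : u n * 1 <= u n * ramp (b - n%:R + 1).
  by rewrite ler_wpM2l//; apply: le_trans (ramp_ge _); lra.
have : 0 <= \sum_(i < (Num.trunc b).+2 | i != Ordinal nN) u i * ramp (b - i%:R + 1).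
  by apply: sumr_ge0 => i _; rewrite mulr_ge0// ramp_ge0.
lra.
Qed.

Lemma envelope_gt0 u b : (forall n, 0 <= u n) -> 0 < b -> 0 < envelope u b.
Proof.
by move=> u0 b0; rewrite ltr_wpDr//; apply: sumr_ge0 => i _; rewrite mulr_ge0// ramp_ge0.
Qed.

Lemma envelope_lt u b b' : (forall n, 0 <= u n) -> 0 < b -> b < b' ->
  envelope u b < envelope u b'.
Proof.
move=> u0 b0 bb'; have b'0 := lt_trans b0 bb'.
rewrite (@envelopeE u (Num.trunc b').+2 b)//; last first.
  have /andP[_ /ltW] := truncn_itv (ltW b'0).
  rewrite -[(Num.trunc b').+2]addn1 natrD; lra.
rewrite /envelope /envsum ltr_leD// ler_sum// => i _.
by rewrite ler_wpM2l// le_ramp//; lra.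
Qed.

End Envelope.

(** * Growth of the derivatives of ln f *)

Section Growth.
Variable R : realType.
Implicit Types (x y t C : R).

(** One number plays amplitude and rate, so a bound is weakened simply by enlarging [C], and
    products and powers keep the same shape. *)
Definition ew C x : R := C * expR (C * `|x|).

Lemma le_ew C C' x y : 0 <= C -> C <= C' -> `|x| <= `|y| -> ew C x <= ew C' y.
Proof.
by move=> C0 CC xy; rewrite /ew ler_pM ?expR_ge0// ler_expR ler_pM.
Qed.

Lemma ew_ge C x : 0 <= C -> C <= ew C x.
Proof. by move=> C0; rewrite ler_peMr// -expR0 ler_expR mulr_ge0. Qed.

Lemma ew_ge0 C x : 0 <= C -> 0 <= ew C x.
Proof. by move=> C0; exact: le_trans (ew_ge x C0). Qed.

Lemma horner_growth (L : {poly R}) : exists2 K, 0 <= K & forall x, `|L.[x]| <= ew K x.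
Proof.
set n := size L; set W := \sum_(i < n) `|L`_i|.
have W0 : 0 <= W by apply: sumr_ge0.
exists (W + n%:R); first by rewrite addr_ge0.
move=> x; apply: (@le_trans _ _ (W * expR (n%:R * `|x|))); last first.
  by rewrite ler_pM ?expR_ge0 ?lerDl// ler_expR ler_wpM2r// lerDr.
rewrite horner_coef; apply: le_trans (ler_norm_sum _ _ _) _.
rewrite mulr_suml ler_sum// => i _; rewrite normrM ler_wpM2l// normrX.
rewrite (@le_trans _ _ (expR `|x| ^+ i))// ?lerXn2r ?nnegrE ?expR_ge0//.
  by apply: le_trans (expR_ge1Dx _); rewrite lerDr.
by rewrite -expRM_natl ler_expR ler_wpM2r// ler_nat ltnW.
Qed.

Lemma powR_le1D (a b : R) : 0 <= a -> 0 <= b <= 1 -> a `^ b <= 1 + a.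
Proof.
move=> a0 /andP[b0 b1]; have [a1|/ltW a1] := leP a 1.
  have -> : 1 + a = 1 `^ b + a by rewrite powR1.
  by rewrite ler_wpDr// ge0_ler_powR// nnegrE.
apply: (@le_trans _ _ (a `^ 1)); first by rewrite ler_powR.
by rewrite powRr1// lerDr.
Qed.

Lemma is_derive_derive1n (r k : nat) (g : R -> R) x : ntimes_derivable r g -> (k < r)%N ->
  is_derive x 1 (derive1n k g) (derive1n k.+1 g x).
Proof.
move=> gr kr; rewrite derive1nS derive1E.
by apply/derivableP; exact: gr.
Qed.

(** A chain of steps no longer than [gam] joins [0] to [x]. Their number is at most [1 + |x| / gam],
    which one more exponential absorbs; the exponent [b] enters only through
    [gam ^ b <= 1 + gam]. *)
Lemma top_derivative_growth (gam lp : R) (h : R -> R) (K b : R) :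
  0 < gam -> 0 < lp -> 0 <= K -> 0 < b <= 1 ->
  (forall x y, `|y - x| <= gam -> `|h x - h y| <= ew K x * `|y - x| `^ b) ->
  `|h 0| <= lp -> forall x, `|h x| <= ew (lp + (1 + gam) * K + K + gam^-1) x.
Proof.
move=> gam0 lp0 K0 /andP[b0 b1] hh h0.
have H n x : `|x| <= n%:R * gam -> `|h x| <= lp + n%:R * ((1 + gam) * ew K x).
  elim: n x => [|n IH] x xn.
    by move: xn; rewrite !mul0r addr0 normr_le0 => /eqP ->.
  have n1 : 0 < n.+1%:R :> R by rewrite ltr0n.
  (* The previous point of the chain, on the segment from [0] to [x], so the growth bound at [y] is
     dominated by the one at [x]. *)
  pose y := x * (n%:R / n.+1%:R).
  have c1 : 0 <= (n%:R / n.+1%:R : R) <= 1.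
    by rewrite divr_ge0//= ler_pdivrMr// mul1r ler_nat.
  have yx : `|y - x| <= gam.
    have -> : y - x = - (x / n.+1%:R).
      have nE : n%:R = n.+1%:R - 1 :> R by rewrite -natr1 addrK.
      by rewrite /y nE; field; exact: lt0r_neq0.
    by rewrite normrN normrM normfV normr_nat ler_pdivrMr// mulrC.
  have y1 : `|y| <= `|x|.
    rewrite /y normrM ler_piMr//; case/andP: c1 => *; by rewrite ger0_norm.
  have yn : `|y| <= n%:R * gam.
    rewrite /y normrM [X in _ * X]ger0_norm; last by case/andP: c1.
    rewrite mulrA ler_pdivrMr//; have := ler_wpM2r (ler0n R n) xn; lra.
  have := IH y yn; have := hh x y yx.
  have B : `|y - x| `^ b <= 1 + gam.
    apply: (@le_trans _ _ (gam `^ b)).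
      by rewrite ge0_ler_powR ?nnegrE ?(ltW b0) ?(ltW gam0).
    by rewrite powR_le1D ?(ltW gam0)// (ltW b0).
  have e1 := ew_ge0 x K0.
  have : ew K x * `|y - x| `^ b <= ew K x * (1 + gam) by rewrite ler_wpM2l.
  have : n%:R * ((1 + gam) * ew K y) <= n%:R * ((1 + gam) * ew K x).
    rewrite ler_wpM2l// ler_wpM2l//; first by rewrite addr_ge0// ltW.
    exact: le_ew.
  have : `|h x| <= `|h x - h y| + `|h y|.
    by rewrite -[X in `|X| <= _](subrK (h y)) ler_normD.
  by rewrite -natr1 mulrDl; lra.
move=> x; set n := (Num.trunc (`|x| / gam)).+1.
have xg : 0 <= `|x| / gam by rewrite divr_ge0// ltW.
have /andP[n1 n2] := truncn_itv xg.
have xn : `|x| <= n%:R * gam by rewrite -ler_pdivrMr// ltW.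
apply: le_trans (H n x xn) _.
have nb : n%:R <= expR (gam^-1 * `|x|).
  by apply: le_trans (expR_ge1Dx _); rewrite /n -natr1 addrC [gam^-1 * _]mulrC lerD2l.
have g0 : 0 < gam^-1 by rewrite invr_gt0.
apply: (@le_trans _ _ (lp + (1 + gam) * K * expR ((K + gam^-1) * `|x|))).
  rewrite lerD2l /ew [(K + gam^-1) * _]mulrDl expRD.
  have -> : (1 + gam) * K * (expR (K * `|x|) * expR (gam^-1 * `|x|)) =
    expR (gam^-1 * `|x|) * ((1 + gam) * (K * expR (K * `|x|))) by ring.
  by rewrite ler_wpM2r// !mulr_ge0 ?expR_ge0// addr_ge0// ltW.
have gK : 0 <= (1 + gam) * K by rewrite mulr_ge0// addr_ge0// ltW.
set D := lp + _ + _ + _; have D0 : 0 <= D by rewrite /D !addr_ge0// ltW.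
apply: (@le_trans _ _ ((lp + (1 + gam) * K) * expR (D * `|x|))).
  rewrite [leRHS]mulrDl; apply: lerD.
    by rewrite ler_peMr ?(ltW lp0)// -expR0 ler_expR mulr_ge0.
  by rewrite ler_wpM2l// ler_expR ler_wpM2r// /D -addrA lerDr addr_ge0// ltW.
by rewrite /ew ler_wpM2r ?expR_ge0// /D -addrA lerDl addr_ge0// ltW.
Qed.

(** Integrating from [0] lowers the order by one. It adds the initial value [lp] and a factor
    [|x| <= exp |x|]; raising the constant by [lp + 1] pays for both. *)
Lemma derivatives_growth (r : nat) (g : R -> R) (lp C : R) :
  0 < lp -> 0 <= C -> ntimes_derivable r g ->
  (forall x, `|derive1n r g x| <= ew C x) ->
  (forall j, (j <= r)%N -> `|derive1n j g 0| <= lp) ->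
  forall j, (j <= r)%N -> forall x, `|derive1n j g x| <= ew (C + r%:R * (lp + 1)) x.
Proof.
move=> lp0 C0 gr gC g0.
have lp1 : 0 <= lp + 1 by rewrite addr_ge0// ltW.
have H i : (i <= r)%N -> forall x, `|derive1n (r - i) g x| <= ew (C + i%:R * (lp + 1)) x.
  elim: i => [|i IH] ir x; first by rewrite subn0 mul0r addr0.
  have ri : (r - i.+1 < r)%N by lia.
  have E : ((r - i.+1).+1 = r - i)%N by lia.
  set Ci := C + i%:R * (lp + 1) in IH.
  have Ci0 : 0 <= Ci by rewrite addr_ge0// mulr_ge0.
  have D : `|derive1n (r - i.+1) g x - derive1n (r - i.+1) g 0| <= ew Ci x * `|x - 0|.
    apply: (@mvt_norm_le R _ (derive1n (r - i) g)) => [y|y yx].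
      by rewrite -E; exact: is_derive_derive1n gr ri.
    apply: le_trans (IH (ltnW ir) y) _; apply: le_ew => //.
    by have [?|?] := ger0P x; have [?|?] := ger0P y; case/orP: yx => /andP[? ?]; lra.
  rewrite subr0 in D.
  have j0 := g0 _ (ltnW ri).
  have x1 : `|x| <= expR `|x| by apply: le_trans (expR_ge1Dx _); rewrite lerDr.
  have E1 : ew Ci x * `|x| <= Ci * expR ((Ci + 1) * `|x|).
    by rewrite /ew -mulrA ler_wpM2l// [(Ci + 1) * _]mulrDl mul1r expRD ler_wpM2l// expR_ge0.
  have -> : C + i.+1%:R * (lp + 1) = Ci + (lp + 1) by rewrite /Ci -natr1; ring.
  rewrite /ew; set e := expR _.
  have e1 : 1 <= e by rewrite -[leLHS]expR0 ler_expR mulr_ge0// addr_ge0.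
  have E2 : Ci * expR ((Ci + 1) * `|x|) <= Ci * e.
    by rewrite ler_wpM2l// ler_expR ler_wpM2r// lerD2l lerDr ltW.
  have E3 := ler_normD (derive1n (r - i.+1) g x - derive1n (r - i.+1) g 0)
    (derive1n (r - i.+1) g 0).
  rewrite subrK in E3.
  have E4 : lp * 1 <= lp * e by rewrite ler_wpM2l// ltW.
  have E5 : (Ci + (lp + 1)) * e = Ci * e + lp * e + e by ring.
  rewrite E5; lra.
move=> j jr x; have := H (r - j)%N (leq_subr _ _) x; rewrite subKn// => /le_trans; apply.
by apply: le_ew => //; [rewrite addr_ge0// mulr_ge0|rewrite lerD2l ler_wpM2r// ler_nat leq_subr].
Qed.

Definition tpoly (g : R -> R) x (k : nat) : {poly R} :=
  \poly_(j < k.+1) (derive1n j g x / j`!%:R).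

Lemma deriv_tpoly g x k : (tpoly g x k.+1)^`() = tpoly (derive1 g) x k.
Proof.
apply/polyP => i; rewrite coef_deriv !coef_poly ltnS.
case: ifP => _; last by rewrite mul0rn.
rewrite -derive1Sn factS natrM -[_ *+ _]mulr_natr.
by field; rewrite pnatr_eq0 -lt0n fact_gt0 addrC natr1 pnatr_eq0.
Qed.

(** The remainder is controlled by the oscillation of the [k]-th derivative, the form in which a
    Hölder condition is given. Differentiating the remainder gives that of [derive1 g] one order
    lower, hence the induction. *)
Lemma taylor_le (k : nat) (g : R -> R) (x t A : R) : 0 <= A -> ntimes_derivable k g ->
  (forall s, `|s| <= `|t| -> `|derive1n k g (x + s) - derive1n k g x| <= A) ->
  `|g (x + t) - (tpoly g x k).[t]| <= A * `|t| ^+ k.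
Proof.
elim: k g t => [|k IH] g t A0 gk gA.
  rewrite expr0 mulr1 /tpoly poly_def big_ord1 expr0 hornerZ hornerC !mulr1 fact0 divr1.
  exact: gA.
pose G s := g (x + s) - (tpoly g x k.+1).[s].
have G' (s : R) : is_derive s 1 G ((derive1 g) (x + s) - (tpoly (derive1 g) x k).[s]).
  have D0 : is_derive s 1 (horner (tpoly g x k.+1)) (tpoly (derive1 g) x k).[s].
    by rewrite -deriv_tpoly; exact: is_derive_poly.
  apply: is_deriveB => //.
  have D1 : is_derive s 1 (fun s : R => x + s) 1.
    by apply: is_derive_eq; rewrite ?mulr1 add0r.
  have D2 := @is_derive_derive1n k.+1 0 g (x + s) gk isT.
  by have := @is_derive1_comp R g (fun s => x + s) s _ _ D2 D1; rewrite mulr1.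
have g'k : ntimes_derivable k (derive1 g).
  by move=> j jk y; rewrite -derive1Sn; apply: gk.
have B s : (0 <= s <= t) || (t <= s <= 0) ->
    `|(derive1 g) (x + s) - (tpoly (derive1 g) x k).[s]| <= A * `|t| ^+ k.
  move=> st; have {}st : `|s| <= `|t|.
    by have [?|?] := ger0P s; have [?|?] := ger0P t; case/orP: st => /andP[? ?]; lra.
  apply: le_trans (IH (derive1 g) s A0 g'k _) _; last by rewrite ler_wpM2l// lerXn2r.
  by move=> u us; rewrite -!derive1Sn; apply: gA; exact: le_trans us st.
have := mvt_norm_le G' B.
have -> : G 0 = 0.
  rewrite /G addr0 horner_coef0 coef_poly/= fact0 divr1; exact: subrr.
by rewrite !subr0 /G exprSr mulrA.
Qed.

End Growth.

(** * Local expansion of f *)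

Section Expansion.
Variable R : realType.
Implicit Types (x y t C : R) (p : {poly R}).

Lemma expR_lipschitz x y c : x <= c -> y <= c -> `|expR x - expR y| <= `|x - y| * expR c.
Proof.
move=> xc yc; rewrite mulrC.
apply: (mvt_norm_le (@is_derive_expR R)) => z.
rewrite ger0_norm ?expR_ge0// ler_expR.
by case/orP => /andP[? ?]; lra.
Qed.

Lemma derive1n_expR (n : nat) : derive1n n (@expR R) = expR.
Proof.
elim: n => [//|n IH]; rewrite derive1nS IH; apply/funext => x.
by rewrite derive1E derive_val.
Qed.

Lemma expR_taylor (r : nat) x :
  `|expR x - \sum_(i < r.+1) x ^+ i / i`!%:R| <= `|x| ^+ r.+1 * expR `|x|.
Proof.
have tE : (tpoly expR 0 r).[x] = \sum_(i < r.+1) x ^+ i / i`!%:R.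
  rewrite /tpoly horner_poly; apply: eq_bigr => i _.
  by rewrite derive1n_expR expR0 mul1r mulrC.
have -> : `|x| ^+ r.+1 * expR `|x| = `|x| * expR `|x| * `|x| ^+ r by rewrite exprS; ring.
rewrite -tE -[X in expR X - _]add0r; apply: taylor_le.
- by rewrite mulr_ge0// expR_ge0.
- by move=> k _ y; rewrite derive1n_expR; exact: derivable_expR.
- move=> s st; rewrite derive1n_expR add0r.
  apply: (@le_trans _ _ (`|s - 0| * expR `|x|)).
    by apply: expR_lipschitz => //; apply: le_trans st; exact: ler_norm.
  by rewrite subr0 ler_wpM2r// expR_ge0.
Qed.

Lemma coef_exp_le (D i : nat) p A : 0 <= A -> (forall j, `|p`_j| <= A) ->
  forall j, (j <= D)%N -> `|(p ^+ i)`_j| <= (D.+1%:R * A) ^+ i.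
Proof.
move=> A0 pA; elim: i => [|i IH] j jD.
  by rewrite !expr0 coef1; case: eqP => _; rewrite ?normr1 ?normr0.
rewrite exprS coefM; apply: le_trans (ler_norm_sum _ _ _) _.
apply: (@le_trans _ _ (\sum_(l < j.+1) A * (D.+1%:R * A) ^+ i)).
  apply: ler_sum => l _; rewrite normrM ler_pM// IH//.
  exact: leq_trans (leq_subr _ _) jD.
rewrite sumr_const card_ord -[_ *+ _]mulr_natl exprS mulrA.
rewrite ler_wpM2r ?exprn_ge0 ?mulr_ge0// ler_wpM2r// ler_nat; lia.
Qed.

(** Passes from the Taylor polynomial [p] of an increment of [ln f] to an expansion of the ratio of
    values of [f]. The loss is polynomial in [A], so coefficients of exponential growth in the base
    point keep exponential growth. *)
Lemma exp_poly_expansion (r : nat) : exists2 c : R, 1 <= c & forall p A, 1 <= A ->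
  (size p <= r.+1)%N -> p`_0 = 0 -> (forall j, `|p`_j| <= A) ->
  exists q : {poly R}, [/\ (size q <= r.+1)%N, q`_0 = 1, (forall j, `|q`_j| <= c * A ^+ r) &
    forall t, `|t| <= 1 -> `|p.[t]| <= r%:R * A * `|t| /\
      `|expR p.[t] - q.[t]| <= c * A ^+ r.+1 * `|t| ^+ r.+1 * expR (r%:R * A * `|t|)].
Proof.
(* The truncated exponential of [p] has degree at most [D] and coefficients at most [c0 A ^ r]. In
   [c], [D c0] covers the discarded degrees above [r], and [r ^ (r + 1)] the Taylor remainder of the
   exponential. *)
pose D := (r * r)%N; pose c0 : R := r.+1%:R * D.+1%:R ^+ r.
pose c : R := c0 + D%:R * c0 + r%:R ^+ r.+1.
have c01 : 1 <= c0.
  by rewrite /c0 -natrX -natrM (ler_nat R 1) muln_gt0 expn_gt0.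
have c00 : 0 <= c0 by lra.
have Dc0 : 0 <= D%:R * c0 by rewrite mulr_ge0.
have rr0 : 0 <= r%:R ^+ r.+1 :> R by rewrite exprn_ge0.
exists c; first by rewrite /c; lra.
move=> p A A1 pr p0 pA.
have A0 : 0 <= A by lra.
pose E := \sum_(i < r.+1) (i`!%:R^-1 : R) *: p ^+ i.
have sE : (size E <= D.+1)%N.
  apply: leq_trans (size_sum _ _ _) _; apply/bigmax_leqP => i _.
  apply: leq_trans (size_scale_leq _ _) _.
  apply: leq_trans (size_poly_exp_leq _ _) _; rewrite ltnS /D.
  by apply: leq_mul; [rewrite -ltnS; lia|rewrite -ltnS].
have Ej j : (j <= D)%N -> `|E`_j| <= c0 * A ^+ r.
  move=> jD; rewrite /E coef_sum; apply: le_trans (ler_norm_sum _ _ _) _.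
  apply: (@le_trans _ _ (\sum_(i < r.+1) (D.+1%:R * A) ^+ r)).
    apply: ler_sum => i _; rewrite coefZ normrM normfV normr_nat.
    apply: (@le_trans _ _ (1 * (D.+1%:R * A) ^+ i)).
      rewrite ler_pM ?invr_ge0 ?coef_exp_le//.
      by rewrite invf_le1 ?ltr0n ?fact_gt0// (ler_nat R 1) fact_gt0.
    rewrite mul1r ler_weXn2l//; last by rewrite -ltnS.
    have : 1 * 1 <= D.+1%:R * A by rewrite ler_pM// (ler_nat R 1).
    by rewrite mul1r.
  by rewrite sumr_const card_ord -[_ *+ _]mulr_natl exprMn mulrA.
have A1r k : 1 <= A ^+ k by rewrite exprn_ege1.
exists (\poly_(j < r.+1) E`_j); split.
- exact: size_poly.
- rewrite coef_poly/= -horner_coef0 /E horner_sum big_ord_recl/= fact0 invr1 scale1r.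
  rewrite expr0 hornerC big1 ?addr0// => i _.
  by rewrite hornerZ horner_exp horner_coef0 p0 expr0n mulr0.
- move=> j; rewrite coef_poly; case: ifP => [jr|_]; last first.
    by rewrite normr0 mulr_ge0 ?exprn_ge0// /c; lra.
  apply: (@le_trans _ _ (c0 * A ^+ r)).
    by apply: Ej; rewrite /D; move: jr; case: (r) => [|r'] //; nia.
  by rewrite ler_wpM2r ?exprn_ge0// /c; lra.
move=> t t1.
have pt : `|p.[t]| <= r%:R * A * `|t|.
  rewrite (horner_coef_wide _ pr) big_ord_recl p0 mul0r add0r.
  apply: le_trans (ler_norm_sum _ _ _) _.
  apply: (@le_trans _ _ (\sum_(i < r) A * `|t|)).
    apply: ler_sum => i _; rewrite normrM normrX ler_pM ?exprn_ge0//.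
    by rewrite lift0 exprS ler_piMr// exprn_ile1.
  by rewrite sumr_const card_ord -[_ *+ _]mulr_natl mulrA.
split=> //.
have Et : E.[t] = \sum_(i < r.+1) p.[t] ^+ i / i`!%:R.
  by rewrite /E horner_sum; apply: eq_bigr => i _; rewrite hornerZ horner_exp mulrC.
have e1 := expR_taylor r p.[t]; rewrite -Et in e1.
have e2 : `|p.[t]| ^+ r.+1 * expR `|p.[t]| <=
    r%:R ^+ r.+1 * A ^+ r.+1 * `|t| ^+ r.+1 * expR (r%:R * A * `|t|).
  by rewrite -!exprMn ler_pM ?exprn_ge0 ?expR_ge0 ?ler_expR// lerXn2r ?nnegrE// !mulr_ge0.
have rD : (r <= D)%N by rewrite /D; clear; case: r => [|r'] //; nia.
have e3 : `|E.[t] - (\poly_(j < r.+1) E`_j).[t]| <= D%:R * c0 * A ^+ r * `|t| ^+ r.+1.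
  rewrite horner_poly (horner_coef_wide _ sE) -(subnKC rD) -addSn big_split_ord/=.
  rewrite addrAC subrr add0r; apply: le_trans (ler_norm_sum _ _ _) _.
  apply: (@le_trans _ _ (\sum_(i < D - r) c0 * A ^+ r * `|t| ^+ r.+1)).
    apply: ler_sum => i _; rewrite normrM ler_pM//.
      by apply: Ej; rewrite addSn -addnS -leq_subRL// ltn_ord.
    by rewrite normrX ler_wiXn2l// leq_addr.
  rewrite sumr_const card_ord -[_ *+ _]mulr_natl !mulrA.
  by rewrite !ler_wpM2r ?exprn_ge0// ler_nat leq_addl.
have eE : 1 <= expR (r%:R * A * `|t|).
  by rewrite -[leLHS]expR0 ler_expR !mulr_ge0.
have tr : 0 <= `|t| ^+ r.+1 by rewrite exprn_ge0.
apply: le_trans (ler_distD E.[t] _ _) _.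
set T := `|t| ^+ r.+1 in e2 e3 tr *; set ee := expR (r%:R * A * `|t|) in e2 eE *.
have e4 : D%:R * c0 * A ^+ r * T <= D%:R * c0 * A ^+ r.+1 * T * ee.
  apply: (@le_trans _ _ (D%:R * c0 * A ^+ r.+1 * T)).
    by rewrite ler_wpM2r// ler_wpM2l// exprS ler_peMl// exprn_ge0.
  by rewrite ler_peMr// !mulr_ge0 ?exprn_ge0.
have e5 : 0 <= c0 * (A ^+ r.+1 * T * ee).
  by rewrite !mulr_ge0 ?exprn_ge0//; exact: expR_ge0.
have -> : c * A ^+ r.+1 * T * ee = c0 * (A ^+ r.+1 * T * ee) +
  D%:R * c0 * A ^+ r.+1 * T * ee + r%:R ^+ r.+1 * A ^+ r.+1 * T * ee by rewrite /c; ring.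
lra.
Qed.

End Expansion.

(** * Uniform expansion of the ratio f (x + t) / f x *)

Section Ratio.
Variable R : realType.
Implicit Types (x t C X gam beta sigma : R).

Definition regular (r : nat) (gam beta C : R) (g : R -> R) : Prop :=
  [/\ ntimes_derivable r g,
      (forall j x, (j <= r)%N -> `|derive1n j g x| <= ew C x) &
      (forall x y, `|y - x| <= gam -> `|derive1n r g x - derive1n r g y| <=
        ew C x * `|y - x| `^ (beta - r%:R))].

(* The scale [sigma] is small compared with the oscillation of [ln f] on [-X, X]. *)
Definition tame (r : nat) (gam beta C sigma X : R) : Prop :=
  [/\ 0 < sigma <= 1, r.+1%:R * (C * expR (C * X)) * sigma <= 1,
      2 * (C * expR (C * X)) * sigma <= gam & C * expR (C * X) * sigma `^ beta <= 1].

Lemma ew_le_cst C x X : 0 <= C -> `|x| <= X -> ew C x <= C * expR (C * X).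
Proof. by move=> C0 xX; rewrite /ew ler_wpM2l// ler_expR ler_wpM2l. Qed.

(** Keeps the ratio below an exponential in the rescaled variable [t / sigma], which a Gaussian of
    scale [sigma] dominates. For [r = 0], where no derivative is at hand, the Hölder condition
    serves up to [gam]; further out, twice the size of [g] is already below [|t| / sigma]. *)
Lemma oscillation r gam beta C g sigma X x t : 1 <= C -> 0 < gam ->
  r%:R < beta <= r.+1%:R -> regular r gam beta C g -> tame r gam beta C sigma X ->
  `|x| <= X -> `|x + t| <= X -> `|g (x + t) - g x| <= 1 + `|t| / sigma.
Proof.
move=> C1 g0 /andP[rb br] [gr gC gH] [/andP[s0 s1] t1 t2 t3] xX xtX.
have C0 : 0 <= C by lra.
set E := C * expR (C * X) in t1 t2 t3.
have E0 : 0 <= E by rewrite mulr_ge0// expR_ge0.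
have ts0 : 0 <= `|t| / sigma by rewrite divr_ge0// ltW.
have tE : `|t| = `|t| / sigma * sigma by rewrite divfK// gt_eqF.
case: r rb br gr gC gH t1 => [|r] rb br gr gC gH t1.
  have [tg|/ltW tg] := leP `|t| gam.
    have := gH x (x + t); rewrite [x + t - x]addrAC subrr add0r => /(_ tg)/= H.
    rewrite distrC; apply: le_trans H _; rewrite subr0.
    apply: (@le_trans _ _ (E * `|t| `^ beta)).
      by rewrite ler_wpM2r ?powR_ge0// ew_le_cst.
    rewrite [in `|t| `^ _]tE powRM//; last exact: ltW.
    have : (`|t| / sigma) `^ beta <= 1 + `|t| / sigma by rewrite powR_le1D// ltW.
    move=> H; rewrite mulrC -mulrA.
    apply: (@le_trans _ _ ((1 + `|t| / sigma) * (sigma `^ beta * E))).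
      by rewrite ler_wpM2r// mulr_ge0// powR_ge0.
    by rewrite ler_piMr ?addr_ge0// mulrC.
  have E2 : 2 * E <= `|t| / sigma.
    by rewrite ler_pdivlMr//; exact: le_trans tg.
  apply: le_trans (ler_normB _ _) _.
  have := le_trans (gC 0%N (x + t) isT) (ew_le_cst C0 xtX).
  have := le_trans (gC 0%N x isT) (ew_le_cst C0 xX).
  rewrite -/E /=; lra.
have D (y : R) : is_derive y 1 g (derive1n 1 g y) by exact: (@is_derive_derive1n R r.+1 0).
have B y : (x <= y <= x + t) || (x + t <= y <= x) -> `|derive1n 1 g y| <= E.
  move=> yx; apply: le_trans (gC 1%N y isT) _; apply: ew_le_cst => //.
  have [?|?] := ger0P y; move: xX xtX; rewrite !ler_norml => /andP[? ?] /andP[? ?];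
    by case/orP: yx => /andP[? ?]; lra.
have := mvt_norm_le D B; rewrite [x + t - x]addrAC subrr add0r => /le_trans; apply.
rewrite {1}tE mulrA mulrAC.
have : E * sigma <= 1.
  apply: le_trans t1; rewrite ler_wpM2r ?(ltW s0)// ler_peMl//.
  by rewrite (ler_nat R 1).
move=> Es; have := ler_wpM2r ts0 Es; lra.
Qed.

Lemma combine_bounds (A B T c K e e' : R) : 0 <= A -> A <= B -> 0 <= T -> 0 <= e -> e <= e' ->
  0 <= c -> 4 + c <= K ->
  A * T * (4 * e) + c * B * (T * e) <= K * B * (T * e').
Proof.
move=> A0 AB T0 e0 ee c0 cK; have B0 := le_trans A0 AB.
apply: (@le_trans _ _ ((4 + c) * B * (T * e))).
  have h : 0 <= 4 * (T * e) by rewrite !mulr_ge0.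
  by have := ler_wpM2r h AB; lra.
by rewrite ler_pM ?mulr_ge0 ?addr_ge0// ?ler_wpM2r ?ler_wpM2l.
Qed.

(** [C'] is fixed before [beta], [g] and [sigma], hence uniform on [(r, r + 1]]. The factor
    [exp (C' |t| / sigma)] lets the estimate hold for all [t] in the window and not only near 0. *)
Lemma ratio_expansion r gam C : 0 < gam -> 1 <= C -> exists2 C', 1 <= C' &
  forall beta g sigma X, r%:R < beta <= r.+1%:R -> regular r gam beta C g ->
  tame r gam beta C sigma X -> forall x, `|x| <= X -> exists q : {poly R},
  [/\ (size q <= r.+1)%N, q`_0 = 1, (forall j, `|q`_j| <= ew C' x) &
    forall t, `|x + t| <= X -> `|expR (g (x + t) - g x) - q.[t]| <=
      ew C' x * (`|t| `^ beta * expR (C' * (`|t| / sigma)))].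
Proof.
move=> g0 C1; have [c c1 H] := exp_poly_expansion R r.
pose g1 := Num.min gam 1; have g10 : 0 < g1 by rewrite /g1 lt_min g0 ltr01.
have g11 : g1 <= 1 by rewrite /g1 ge_min lexx orbT.
pose K : R := (4 + r.+1%:R * c) * (g1 ^+ r.+1)^-1.
have gi1 : 1 <= (g1 ^+ r.+1)^-1.
  by rewrite invf_ge1 ?exprn_gt0// exprn_ile1// ltW.
have r1 : 1 <= r.+1%:R :> R by rewrite (ler_nat R 1).
have c0 : 0 <= c by exact: le_trans c1.
have rc : c <= r.+1%:R * c by rewrite ler_peMl.
have rc0 : 0 <= r.+1%:R * c by rewrite mulr_ge0.
have Kc : 4 + r.+1%:R * c <= K by rewrite ler_peMr// addr_ge0.
have cK : 4 + c <= K by apply: le_trans Kc; rewrite lerD2l.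
have C0 : 0 <= C by lra.
have Cr : 1 <= C ^+ r.+1 by rewrite exprn_ege1.
have KC : K <= K * C ^+ r.+1 by rewrite ler_peMr//; lra.
have rC : 0 <= r.+1%:R * C by rewrite mulr_ge0.
have K0 : 0 <= K by lra.
exists (K * C ^+ r.+1 + r.+1%:R * C + r.+1%:R); first lra.
set C' := _ + _ + _; have C'0 : 0 <= C' by rewrite /C'; lra.
move=> beta g sigma X rbr greg gtame x xX.
have osc t := @oscillation r gam beta C g sigma X x t C1 g0 rbr greg gtame xX.
move: rbr greg gtame => /andP[rb br] [gr gC gH] [/andP[s0 s1] t1 t2 t3].
set A := ew C x.
have A1 : 1 <= A by apply: le_trans C1 _; exact: ew_ge.
have A0 : 0 <= A by exact: le_trans A1.
have Ar k : 1 <= A ^+ k by rewrite exprn_ege1.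
have KA : K * A ^+ r.+1 <= ew C' x.
  rewrite /A /ew exprMn mulrA -expRM_natl ler_pM ?expR_ge0//.
  - by rewrite mulr_ge0 ?exprn_ge0//; lra.
  - by rewrite -[C']addrA lerDl addr_ge0.
  - by rewrite ler_expR mulrA ler_wpM2r// -[C']addrA addrCA lerDl addr_ge0// mulr_ge0// exprn_ge0.
pose p := tpoly g x r - (g x)%:P.
have sp : (size p <= r.+1)%N.
  apply: leq_trans (size_polyD _ _) _; rewrite geq_max size_poly size_polyN.
  by apply: leq_trans (size_polyC_leq1 _) _.
have p0 : p`_0 = 0 by rewrite /p coefB coefC coef_poly/= fact0 divr1 subrr.
have pA j : `|p`_j| <= A.
  case: j => [|j]; first by rewrite p0 normr0.
  rewrite /p coefB coefC subr0 coef_poly; case: ifP => [jr|_]; last by rewrite normr0.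
  rewrite normrM normfV normr_nat ler_pdivrMr ?ltr0n ?fact_gt0//.
  apply: le_trans (gC j.+1 x jr) _; rewrite ler_peMr//.
  by rewrite (ler_nat R 1) fact_gt0.
have [q [sq q0 qA qE]] := H p A A1 sp p0 pA.
have qA' j : `|q`_j| <= K * A ^+ r.+1.
  apply: le_trans (qA j) _; rewrite exprS mulrA ler_wpM2r ?exprn_ge0//.
  by apply: le_trans (ler_peMr K0 A1); apply: le_trans cK; rewrite lerDr.
exists q; split=> // [j|t xtX]; first exact: le_trans (qA' j) KA.
set z := `|t| / sigma.
have z0 : 0 <= z by rewrite divr_ge0// ltW.
have tz : `|t| <= z by rewrite ler_pdivlMr// ler_piMr.
have oz : `|g (x + t) - g x| <= 1 + z by exact: osc.
have C'r : r.+1%:R <= C' by rewrite lerDr addr_ge0// mulr_ge0// exprn_ge0.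
suff S : `|expR (g (x + t) - g x) - q.[t]| <= K * A ^+ r.+1 * (`|t| `^ beta * expR (r.+1%:R * z)).
  apply: le_trans S _; apply: ler_pM => //.
  - by rewrite mulr_ge0 ?exprn_ge0.
  - by rewrite ler_wpM2l ?powR_ge0// ler_expR ler_wpM2r.
have e1z : expR (1 + z) <= 4 * expR z by rewrite expRD ler_wpM2r ?expR_ge0// expR1_le4.
have ezr : expR z <= expR (r.+1%:R * z) by rewrite ler_expR ler_peMl.
have beta0 : 0 <= beta by apply: le_trans (ltW rb).
have [tg|tg] := leP `|t| g1.
  have t1' : `|t| <= 1 by exact: le_trans g11.
  have tgam : `|t| <= gam by apply: le_trans tg _; rewrite /g1 ge_min lexx.
  have [pz qz] := qE t t1'.
  have rAz : r%:R * A * `|t| <= z.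
    rewrite /z ler_pdivlMr// mulrAC ler_piMl//.
    apply: le_trans t1; rewrite ler_wpM2r ?(ltW s0)// ler_pM ?ler_nat//.
    exact: ew_le_cst.
  have Rt : `|g (x + t) - g x - p.[t]| <= A * `|t| `^ beta.
    have b1 : 0 < beta - r%:R by rewrite subr_gt0.
    have := @taylor_le R r g x t (A * `|t| `^ (beta - r%:R)).
    rewrite mulr_ge0 ?powR_ge0// => /(_ isT gr).
    have -> : g (x + t) - g x - p.[t] = g (x + t) - (tpoly g x r).[t].
      by rewrite /p hornerD hornerN hornerC; ring.
    move=> T; apply: le_trans (T _) _.
      move=> s st; rewrite distrC.
      have := gH x (x + s); rewrite [x + s - x]addrAC subrr add0r.
      move=> /(_ (le_trans st tgam)) /le_trans; apply.
      by rewrite ler_wpM2l// ge0_ler_powR ?nnegrE// ltW.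
    rewrite -mulrA -powR_mulrn// -powRD; first by rewrite subrK.
    by rewrite subrK gt_eqF// (le_lt_trans _ rb).
  have L : `|expR (g (x + t) - g x) - expR p.[t]| <= A * `|t| `^ beta * (4 * expR z).
    apply: (@le_trans _ _ (`|g (x + t) - g x - p.[t]| * expR (1 + z))).
      apply: expR_lipschitz; first by apply: le_trans oz; exact: ler_norm.
      by apply: le_trans (ler_norm _) _; apply: le_trans pz (le_trans rAz _); rewrite lerDr.
    by rewrite ler_pM ?expR_ge0.
  have M : `|expR p.[t] - q.[t]| <= c * A ^+ r.+1 * (`|t| `^ beta * expR z).
    apply: le_trans qz _; rewrite -mulrA ler_wpM2l ?mulr_ge0 ?exprn_ge0//.
    rewrite ler_pM ?exprn_ge0 ?expR_ge0 ?ler_expR// -powR_mulrn//.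
    have [->|tn0] := eqVneq t 0.
      by rewrite normr0 powR0 ?pnatr_eq0// powR_ge0.
    by rewrite ger_powR// normr_gt0 tn0.
  apply: le_trans (ler_distD (expR p.[t]) _ _) _.
  set T := `|t| `^ beta in L M *; have T0 : 0 <= T by exact: powR_ge0.
  have AA : A <= A ^+ r.+1 by rewrite exprS ler_peMr.
  apply: le_trans (lerD L M) _.
  exact: combine_bounds A0 AA T0 (expR_ge0 _) ezr c0 cK.
have tb : 1 <= (g1 ^+ r.+1)^-1 * `|t| `^ beta.
  rewrite mulrC ler_pdivlMr ?exprn_gt0// mul1r -powR_mulrn ?(ltW g10)//.
  apply: (@le_trans _ _ (g1 `^ beta)); first by rewrite ger_powR// g10.
  by rewrite ge0_ler_powR ?nnegrE// ltW.
have Q : `|q.[t]| <= r.+1%:R * c * A ^+ r.+1 * expR (r.+1%:R * z).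
  rewrite (horner_coef_wide _ sq); apply: le_trans (ler_norm_sum _ _ _) _.
  apply: (@le_trans _ _ (\sum_(i < r.+1) c * A ^+ r.+1 * expR (r.+1%:R * z))).
    apply: ler_sum => i _; rewrite normrM normrX ler_pM ?exprn_ge0//.
      apply: le_trans (qA _) _; rewrite ler_wpM2l//.
      by rewrite exprS ler_peMl// exprn_ge0.
    apply: (@le_trans _ _ (expR `|t| ^+ i)).
      rewrite lerXn2r ?nnegrE ?expR_ge0//.
      by apply: le_trans (expR_ge1Dx _); rewrite lerDr.
    by rewrite -expRM_natl ler_expR ler_pM// ler_nat ltnW.
  by rewrite sumr_const card_ord -[_ *+ _]mulr_natl !mulrA.
have G : expR (g (x + t) - g x) <= 4 * A ^+ r.+1 * expR (r.+1%:R * z).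
  apply: (@le_trans _ _ (expR (1 + z))).
    by rewrite ler_expR; apply: le_trans oz; exact: ler_norm.
  apply: le_trans e1z _; rewrite ler_pM ?expR_ge0//.
  by rewrite ler_peMr.
apply: le_trans (ler_normB _ _) _; rewrite ger0_norm ?expR_ge0//.
have -> : K * A ^+ r.+1 * (`|t| `^ beta * expR (r.+1%:R * z)) =
  (4 + r.+1%:R * c) * A ^+ r.+1 * expR (r.+1%:R * z) * ((g1 ^+ r.+1)^-1 * `|t| `^ beta).
  by rewrite /K; ring.
apply: (@le_trans _ _ ((4 + r.+1%:R * c) * A ^+ r.+1 * expR (r.+1%:R * z))).
  have -> : (4 + r.+1%:R * c) * A ^+ r.+1 * expR (r.+1%:R * z) =
    4 * A ^+ r.+1 * expR (r.+1%:R * z) + r.+1%:R * c * A ^+ r.+1 * expR (r.+1%:R * z) by ring.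
  exact: lerD G Q.
by rewrite ler_peMr// !mulr_ge0 ?expR_ge0 ?exprn_ge0// addr_ge0.
Qed.

End Ratio.

(** * Discretisation *)

Section Discretization.
Variable R : realType.
Implicit Types (x y z h t sigma beta : R) (p q : {poly R}).

Definition lat (s : nat) : R := (16 * s%:R)^-1.

(** The two points tested are those left over by [gsum_shift]: the first lattice point and the one
    just after the last. *)
Definition covers (s n : nat) y : Prop :=
  y <= - (16 * s%:R) /\ 16 * s%:R <= y + n%:R * lat s.

Lemma gmean_gsum p (c : R) : gmean p c -> exists C : R, exists s0 : nat, 0 <= C /\
  forall (s n : nat) y, (s0 <= s)%N -> covers s n y ->
  `|gsum (lat s) n p y - c * gsum (lat s) n 1 y| <= C * expR (- s%:R).
Proof.
move=> [q ->]; have [C [s0 [C0 H]]] := trapezoid q.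
exists C, s0; split=> // s n y ss [y1 y2].
by rewrite gsumD -[c%:P]mulr1 mul_polyC gsumZ addrK; exact: H.
Qed.

Lemma gmean_gsum_uniform (P : nat -> {poly R}) (c : nat -> R) (m : nat) :
  (forall j, (j < m)%N -> gmean (P j) (c j)) ->
  exists C : R, exists s0 : nat, 0 <= C /\
  forall (s n : nat) y, (s0 <= s)%N -> covers s n y -> forall j, (j < m)%N ->
  `|gsum (lat s) n (P j) y - c j * gsum (lat s) n 1 y| <= C * expR (- s%:R).
Proof.
elim: m => [|m IH] Pc; first by exists 0, 0%N; split.
have [|C [s0 [C0 H]]] := IH; first by move=> j jm; apply: Pc; exact: ltnW.
have [C1 [s1 [C10 H1]]] := gmean_gsum (Pc m (leqnn _)).
exists (C + C1), (maxn s0 s1); split; first exact: addr_ge0.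
move=> s n y; rewrite geq_max => /andP[ss0 ss1] cy j.
rewrite ltnS leq_eqVlt => /predU1P[->|jm].
  apply: le_trans (H1 s n y ss1 cy) _; rewrite ler_wpM2r ?expR_ge0//; lra.
apply: le_trans (H s n y ss0 cy j jm) _; rewrite ler_wpM2r ?expR_ge0//; lra.
Qed.

(** The phase derivative is the sum for [gop 1], which [trapezoid] makes tiny. One number can
    therefore stand for the sum at every phase. *)
Lemma gsum_phase : exists C : R, exists s0 : nat, 0 <= C /\
  forall (s n : nat) y y', (s0 <= s)%N -> covers s n y -> covers s n y' ->
  `|gsum (lat s) n 1 y' - gsum (lat s) n 1 y| <= C * expR (- s%:R) * `|y' - y|.
Proof.
have [C [s0 [C0 H]]] := trapezoid (1 : {poly R}).
exists C, s0; split=> // s n y y' ss [y1 y2] [y1' y2'].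
apply: (mvt_norm_le (is_derive_gsum (lat s) n 1)) => z zy.
by apply: H => //; rewrite -?/(lat s); case/orP: zy => /andP[? ?]; lra.
Qed.

Lemma lat_bounds s : (0 < s)%N -> 0 < lat s <= 1.
Proof.
move=> s0; have s1 : 1 <= s%:R :> R by rewrite (ler_nat R 1).
by rewrite /lat invr_gt0 invf_le1; [apply/andP; split|]; lra.
Qed.

Lemma gsum1_le s n y : (0 < s)%N -> gsum (lat s) n 1 y <= sumC 0.
Proof.
move=> s0; have h01 := lat_bounds s0.
apply: le_trans (lattice_gauss_le 0 y n h01); apply: ler_sum => k _.
have h0 : 0 <= lat s by case/andP: h01 => /ltW.
rewrite ler_wpM2l// hornerC mul1r /gauss_fun ler_expR mul0r add0r lerN2.
by have := sqr_ge0 (y + k%:R * lat s); lra.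
Qed.

(** The [16 s] lattice points in [[0, 1)] have total weight 1, and there the Gaussian is at least
    [exp (- 1) >= 1 / 4]. *)
Lemma gsum1_ge s (n : nat) : (0 < s)%N -> (16 * s <= n)%N ->
  4^-1 <= gsum (lat s) (2 * n).+1 1 (- (n%:R * lat s)).
Proof.
move=> s0 sn; have /andP[h0 h1] := lat_bounds s0.
have hs : lat s * (16 * s)%:R = 1.
  by rewrite /lat natrM mulVf// mulf_neq0 ?pnatr_eq0// -lt0n.
have E : ((2 * n).+1 = n + (16 * s + (n.+1 - 16 * s)))%N by lia.
rewrite /gsum E big_split_ord/= big_split_ord/=.
set S1 := \sum_(i < n) _; set S2 := \sum_(i < 16 * s) _; set S3 := \sum_(i < _) _.
have pos (m : nat) (u : 'I_m -> R) :
    0 <= \sum_(i < m) lat s * ((1 : {poly R}).[u i] * gauss_fun (u i)).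
  by apply: sumr_ge0 => i _; rewrite hornerC mul1r mulr_ge0 ?gauss_fun_ge0// ltW.
have P1 : 0 <= S1 by exact: pos. have P3 : 0 <= S3 by exact: pos.
suff : 4^-1 <= S2 by lra.
apply: (@le_trans _ _ (\sum_(i < 16 * s) lat s * 4^-1)).
  by rewrite sumr_const card_ord -[lat s * 4^-1 *+ _]mulr_natr mulrAC hs mul1r.
apply: ler_sum => i _; rewrite ler_wpM2l ?(ltW h0)// hornerC mul1r.
have -> : - (n%:R * lat s) + (n + i)%:R * lat s = i%:R * lat s by rewrite natrD; ring.
apply: (@le_trans _ _ (expR (- 1))).
  by rewrite expRN lef_pV2 ?posrE ?expR_gt0// expR1_le4.
rewrite /gauss_fun ler_expR lerN2 exprn_ile1 ?mulr_ge0 ?(ltW h0)//.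
by rewrite -[leRHS]hs mulrC ler_wpM2l ?(ltW h0)// ler_nat ltnW.
Qed.

(** [F] stands for the local ratio of [f], and [q] for its expansion. After exchanging sums, the
    coefficient of [sigma ^ j] carries the [j]-th stencil polynomial, of Gaussian mean 1 for [j = 0]
    and 0 otherwise; only the constant term of [q] survives. *)
Lemma disc_expansion r (a : 'I_r.+1 -> R) (D : R) : 0 <= D ->
  (forall j, (j <= r)%N -> gmean (\sum_i a i *: ('X + (i%:R)%:P) ^+ j) (j == 0%N)%:R) ->
  exists K : R, exists s0 : nat, 0 <= K /\
  forall (s n : nat) y beta sigma q B (F : R -> R), (s0 <= s)%N -> covers s n y ->
    0 < beta <= r.+1%:R -> 0 < sigma <= 1 -> 0 <= B ->
    (size q <= r.+1)%N -> q`_0 = 1 -> (forall j, `|q`_j| <= B) ->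
    (forall (k : 'I_n) (i : 'I_r.+1), let t := sigma * (y + k%:R * lat s + i%:R) in
       `|F t - q.[t]| <= B * (`|t| `^ beta * expR (D * (`|t| / sigma)))) ->
  `|\sum_(k < n) lat s * ((\sum_i a i * F (sigma * (y + k%:R * lat s + i%:R))) *
       gauss_fun (y + k%:R * lat s)) - gsum (lat s) n 1 y| <=
    K * B * (expR (- s%:R) + sigma `^ beta).
Proof.
move=> D0 aP.
have [C [s1 [C0 H]]] := @gmean_gsum_uniform
  (fun j => \sum_i a i *: ('X + (i%:R)%:P) ^+ j) (fun j => (j == 0%N)%:R) r.+1 aP.
(* Growth rate of the remainder in the rescaled variable: [r + 1] from
   [|u| ^ beta <= exp ((r + 1) |u|)], and [D] from its own exponential. The shifts [i <= r] give the
   factor [exp (E r)] below. *)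
pose A := \sum_i `|a i|; pose E := r.+1%:R + D.
have A0 : 0 <= A by apply: sumr_ge0.
have E0 : 0 <= E by rewrite addr_ge0.
pose K2 := A * expR (E * r%:R) * sumC E.
have K20 : 0 <= K2 by rewrite /K2 !mulr_ge0 ?expR_ge0// ltW// sumC_gt0.
have rC : 0 <= r.+1%:R * C by rewrite mulr_ge0.
exists (r.+1%:R * C + K2), (maxn 1 s1); split; first exact: addr_ge0.
move=> s n y beta sigma q B F; rewrite geq_max => /andP[s0 ss1] cy /andP[b0 br].
move=> /andP[sg0 sg1] B0 sq q0 qB FE.
have h01 := lat_bounds s0; have h0 : 0 <= lat s by case/andP: h01 => /ltW.
pose z (k : nat) := y + k%:R * lat s.
have Qsum : \sum_(k < n) lat s * ((\sum_i a i * q.[sigma * (z k + i%:R)]) * gauss_fun (z k)) =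
    \sum_(j < r.+1) q`_j * sigma ^+ j *
      gsum (lat s) n (\sum_i a i *: ('X + (i%:R)%:P) ^+ j) y.
  rewrite /gsum; under [RHS]eq_bigr do rewrite mulr_sumr.
  rewrite exchange_big/=; apply: eq_bigr => k _.
  under [RHS]eq_bigr do rewrite mulrCA.
  rewrite -mulr_sumr; congr (_ * _).
  under [RHS]eq_bigr do rewrite mulrA.
  rewrite -mulr_suml; congr (_ * _).
  under [RHS]eq_bigr do rewrite horner_sum mulr_sumr.
  rewrite exchange_big/=; apply: eq_bigr => i _.
  rewrite (horner_coef_wide _ sq) mulr_sumr; apply: eq_bigr => j _.
  by rewrite hornerZ horner_exp hornerD hornerX hornerC exprMn -/(z k); ring.
have main : `|\sum_(k < n) lat s * ((\sum_i a i * q.[sigma * (z k + i%:R)]) * gauss_fun (z k)) -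
    gsum (lat s) n 1 y| <= r.+1%:R * C * B * expR (- s%:R).
  have -> : gsum (lat s) n 1 y = \sum_(j < r.+1) q`_j * sigma ^+ j *
      ((j == 0%N :> nat)%:R * gsum (lat s) n 1 y).
    rewrite big_ord_recl q0 expr0 eqxx !mul1r big1 ?addr0// => i _.
    by rewrite lift0/= mul0r mulr0.
  rewrite Qsum -sumrB; apply: le_trans (ler_norm_sum _ _ _) _.
  apply: (@le_trans _ _ (\sum_(j < r.+1) B * (C * expR (- s%:R)))).
    apply: ler_sum => j _; rewrite -mulrBr normrM ler_pM//; last exact: H.
    rewrite normrM -[leRHS]mulr1 ler_pM// normrX exprn_ile1//.
    by rewrite gtr0_norm.
  by rewrite sumr_const card_ord -[_ *+ _]mulr_natl; lra.
have err : `|\sum_(k < n) lat s * ((\sum_i a i * F (sigma * (z k + i%:R))) * gauss_fun (z k)) -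
    \sum_(k < n) lat s * ((\sum_i a i * q.[sigma * (z k + i%:R)]) * gauss_fun (z k))| <=
    K2 * B * sigma `^ beta.
  rewrite -sumrB; apply: le_trans (ler_norm_sum _ _ _) _.
  apply: (@le_trans _ _ (\sum_(k < n) A * expR (E * r%:R) * B * sigma `^ beta *
      (lat s * expR (E * `|z k| - z k ^+ 2 / 2)))); last first.
    rewrite -mulr_sumr.
    have -> : K2 * B * sigma `^ beta = A * expR (E * r%:R) * B * sigma `^ beta * sumC E.
      by rewrite /K2; ring.
    rewrite ler_wpM2l ?lattice_gauss_le//.
    by rewrite !mulr_ge0 ?expR_ge0 ?powR_ge0.
  apply: ler_sum => k _; rewrite -mulrBr -mulrBl -sumrB normrM (ger0_norm h0).
  rewrite mulrCA ler_wpM2l// normrM (ger0_norm (gauss_fun_ge0 _)).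
  have S i : `|a i * F (sigma * (z k + i%:R)) - a i * q.[sigma * (z k + i%:R)]| <=
      `|a i| * (expR (E * r%:R) * B * sigma `^ beta * expR (E * `|z k|)).
    rewrite -mulrBr normrM ler_wpM2l//; apply: le_trans (FE k i) _.
    rewrite -/(z k); set u := z k + i%:R.
    rewrite normrM (gtr0_norm sg0) mulrAC divff ?gt_eqF// mul1r.
    rewrite powRM ?(ltW sg0)//.
    have ub : `|u| `^ beta <= expR (r.+1%:R * `|u|).
      have e1 : `|u| <= expR `|u| by apply: le_trans (expR_ge1Dx _); rewrite lerDr.
      apply: (@le_trans _ _ (expR `|u| `^ beta)).
        by rewrite ge0_ler_powR ?nnegrE ?expR_ge0// ltW.
      by rewrite -expRM ler_expR mulrC ler_wpM2r.
    have ul : `|u| <= r%:R + `|z k|.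
      apply: le_trans (ler_normD _ _) _; rewrite addrC lerD2r normr_nat ler_nat.
      by rewrite -ltnS.
    have e2 : expR (r.+1%:R * `|u|) * expR (D * `|u|) <= expR (E * r%:R) * expR (E * `|z k|).
      by rewrite -!expRD ler_expR -mulrDl -/E -mulrDr ler_wpM2l.
    have -> : expR (E * r%:R) * B * sigma `^ beta * expR (E * `|z k|) =
      B * sigma `^ beta * (expR (E * r%:R) * expR (E * `|z k|)) by ring.
    rewrite -mulrA [leLHS]mulrA; apply: ler_wpM2l.
      by rewrite mulr_ge0 ?powR_ge0.
    by apply: le_trans e2; rewrite ler_wpM2r ?expR_ge0.
  have gz : gauss_fun (z k) <= expR (- (z k ^+ 2 / 2)).
    by rewrite /gauss_fun ler_expR lerN2; have := sqr_ge0 (z k); lra.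
  rewrite expRD; set G := expR (E * `|z k|) in S *.
  have -> : A * expR (E * r%:R) * B * sigma `^ beta * (G * expR (- (z k ^+ 2 / 2))) =
    A * (expR (E * r%:R) * B * sigma `^ beta * G) * expR (- (z k ^+ 2 / 2)) by ring.
  rewrite ler_pM ?gauss_fun_ge0//; apply: le_trans (ler_norm_sum _ _ _) _.
  by rewrite /A mulr_suml ler_sum.
apply: le_trans (ler_distD
  (\sum_(k < n) lat s * ((\sum_i a i * q.[sigma * (z k + i%:R)]) * gauss_fun (z k))) _ _) _.
have T0 : 0 <= sigma `^ beta by exact: powR_ge0.
have e0 : 0 <= expR (- s%:R) :> R by exact: expR_ge0.
have X1 : 0 <= K2 * B * expR (- s%:R) by rewrite !mulr_ge0.
have X2 : 0 <= r.+1%:R * C * B * sigma `^ beta by rewrite !mulr_ge0.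
apply: le_trans (lerD err main) _; lra.
Qed.

End Discretization.

(** * The mixture *)

Section Construction.
Variables (R : realType) (r : nat) (a : 'I_r.+1 -> R).
Implicit Types (v x u b C K gam beta : R) (f : R -> R).

(* The scale is written [sigma = exp (- v ^ 2)], so that [v = sqrt |ln sigma|] and every
   length occurring below is linear in [v].  The [k]-th mean is [node v k], with spacing
   [sigma / (16 * scl v)] where [exp (- scl v) <= sigma ^ (r + 3)]; the grid covers
   [|x| <= rad v + 1]. *)
Definition sig v : R := expR (- v ^+ 2).
Definition scl v : nat := (Num.trunc (r.+3%:R * v ^+ 2)).+1.
Definition rad v : R := 8 * r.+2%:R * v.
Definition step v : R := sig v * lat R (scl v).
Definition half v : nat := (Num.trunc ((rad v + 1) / step v)).+1.
Definition node v (k : nat) : R := (k%:R - (half v)%:R) * step v.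
Definition wt v f u : R := \sum_i a i * f (u + i%:R * sig v).
(** The normalising sum frozen at the phase of [x = 0]; its variation with [x] is handled by
    [gsum_phase]. *)
Definition kap v : R :=
  gsum (lat R (scl v)) (2 * half v).+1 1 (- ((half v)%:R * lat R (scl v))).
Definition phase v x : R := - ((half v)%:R * lat R (scl v)) - x / sig v.
Definition mixsum v f x : R := \sum_(k < (2 * half v).+1)
  lat R (scl v) * (wt v f (node v k) * gauss_fun ((node v k - x) / sig v)).

Lemma sig_gt0 v : 0 < sig v. Proof. exact: expR_gt0. Qed.

Lemma sig_le1 v : sig v <= 1.
Proof. by rewrite /sig -[leRHS]expR0 ler_expR oppr_le0 sqr_ge0. Qed.

Lemma sig_powR v b : sig v `^ b = expR (- b * v ^+ 2).
Proof. by rewrite /sig -expRM; congr expR; ring. Qed.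

Lemma scl_bounds v : 1 <= v ->
  r.+3%:R * v ^+ 2 <= (scl v)%:R /\ (scl v)%:R <= r.+4%:R * v ^+ 2.
Proof.
move=> v1; have v2 : 1 <= v ^+ 2 by rewrite exprn_ege1.
have p0 : 0 <= r.+3%:R * v ^+ 2 by rewrite mulr_ge0 ?sqr_ge0.
have /andP[t1 t2] := truncn_itv p0; split; first exact: ltW.
have e4 : r.+4%:R = r.+3%:R + 1 :> R by rewrite natr1.
rewrite /scl; move: t1; move: (Num.trunc _) => T t1.
by rewrite -[T.+1%:R]natr1 e4 mulrDl mul1r; lra.
Qed.

Lemma lat_scl_gt0 v : 0 < lat R (scl v).
Proof. by have /andP[] := @lat_bounds R (scl v) isT. Qed.

Lemma step_gt0 v : 0 < step v.
Proof. by rewrite mulr_gt0 ?sig_gt0 ?lat_scl_gt0. Qed.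

Lemma step_le1 v : step v <= 1.
Proof.
have /andP[l0 l1] := @lat_bounds R (scl v) isT.
by rewrite /step mulr_ile1 ?sig_le1// ltW// sig_gt0.
Qed.

Lemma rad_ge v : 1 <= v -> v <= rad v.
Proof.
move=> v1; rewrite /rad ler_peMl//; first lra.
by rewrite -natrM (ler_nat R 1).
Qed.

Lemma half_bounds v : 1 <= v ->
  rad v + 1 <= (half v)%:R * step v /\ (half v)%:R * step v <= rad v + 2.
Proof.
move=> v1; have s0 := step_gt0 v; have s1 := step_le1 v; have rv := rad_ge v1.
have p0 : 0 <= (rad v + 1) / step v by rewrite divr_ge0 ?(ltW s0)//; lra.
have /andP[t1 t2] := truncn_itv p0; split.
  by rewrite -ler_pdivrMr// ltW.
rewrite /half; move: t1; move: (Num.trunc _) => T t1.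
rewrite -[T.+1%:R]natr1 mulrDl mul1r.
by move: t1; rewrite ler_pdivlMr//; lra.
Qed.

Lemma node_bound v (k : nat) : 1 <= v -> (k < (2 * half v).+1)%N -> `|node v k| <= rad v + 2.
Proof.
move=> v1 kh; have [_ h2] := half_bounds v1; apply: le_trans h2.
rewrite /node normrM (gtr0_norm (step_gt0 v)) ler_wpM2r ?(ltW (step_gt0 v))//.
rewrite ler_norml; apply/andP; split; first by rewrite lerBrDr addrC subrr.
rewrite lerBlDr -natrD ler_nat; lia.
Qed.

Lemma node_phase v x (k : nat) : (node v k - x) / sig v = phase v x + k%:R * lat R (scl v).
Proof.
by rewrite /node /phase /step; field; rewrite gt_eqF ?sig_gt0.
Qed.

Lemma node_at v x (k : nat) : x + sig v * (phase v x + k%:R * lat R (scl v)) = node v k.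
Proof.
by rewrite -node_phase mulrC divfK ?gt_eqF ?sig_gt0//; ring.
Qed.

Section FineScale.
Variables (v : R) (v1 : 1 <= v) (fine_scl : 16 * (scl v)%:R * sig v <= 1).

(** The grid reaches [rad + 1], so a margin 1 remains around [x]; in units of [sig v] it is at least
    [16 scl v] by [fine_scl]. *)
Lemma covers_phase x : `|x| <= rad v -> covers (scl v) (2 * half v).+1 (phase v x).
Proof.
move=> xr; have s0 := sig_gt0 v; have l0 := lat_scl_gt0 v.
have [h1 _] := half_bounds v1.
have S : 16 * (scl v)%:R <= 1 / sig v by rewrite ler_pdivlMr.
have H : (rad v + 1) / sig v <= (half v)%:R * lat R (scl v).
  by rewrite ler_pdivrMr// -mulrA [lat R _ * _]mulrC.
have X : `|x / sig v| <= rad v / sig v.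
  by rewrite normrM normfV (gtr0_norm s0) ler_wpM2r// invr_ge0 ltW.
move: X; rewrite ler_norml => /andP[X1 X2]; rewrite mulrDl in H.
split; rewrite /phase; first lra.
have -> : (2 * half v).+1%:R = 2 * (half v)%:R + 1 :> R by rewrite -natr1 natrM.
have -> : (2 * (half v)%:R + 1) * lat R (scl v) =
  2 * ((half v)%:R * lat R (scl v)) + lat R (scl v) by ring.
lra.
Qed.

Lemma half_ge_scl : (16 * scl v <= half v)%N.
Proof.
have s0 := sig_gt0 v; have [h1 _] := half_bounds v1; have rv := rad_ge v1.
rewrite -(ler_nat R) natrM.
have S1 : 1 <= (half v)%:R * step v.
  by apply: le_trans h1; apply: le_trans (le_trans v1 rv) _; rewrite lerDl.
have lE : 16 * (scl v)%:R * lat R (scl v) = 1.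
  by rewrite /lat mulfV// mulf_neq0 ?pnatr_eq0.
have s16 : 0 <= 16 * (scl v)%:R :> R by rewrite mulr_ge0.
apply: le_trans (ler_peMr s16 S1) _.
have -> : 16 * (scl v)%:R * ((half v)%:R * step v) =
  (half v)%:R * sig v * (16 * (scl v)%:R * lat R (scl v)) by rewrite /step; ring.
by rewrite lE mulr1 ler_piMr// sig_le1.
Qed.

Lemma kap_bounds : 4^-1 <= kap v <= sumC 0.
Proof.
by rewrite gsum1_le// andbT; apply: gsum1_ge => //; exact: half_ge_scl.
Qed.

Lemma sig_le_lat : sig v <= lat R (scl v).
Proof.
rewrite /lat -[leRHS]mul1r ler_pdivlMr ?mulr_gt0 ?ltr0n//.
by rewrite mulrC.
Qed.

End FineScale.

(** Common form of the smallness conditions on the scale. The length [10 (r + 2) v] exceeds the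
    radius within which [f] is sampled, shifts included. *)
Lemma eventually_small K b eta : 0 <= K -> 0 < b -> 0 < eta ->
  exists2 v0 : R, 1 <= v0 & forall v, v0 <= v ->
    K * expR (K * (10 * r.+2%:R * v)) * expR (- b * v ^+ 2) <= eta.
Proof.
move=> K0 b0 e0; pose L : R := 10 * r.+2%:R.
have L0 : 0 <= L by rewrite mulr_ge0.
have L1 : 1 <= L by rewrite /L -natrM (ler_nat R 1).
have [v0 v01 H] := gauss_beats_exp (mulr_ge0 K0 L0) b0 e0.
exists v0 => // v /H; apply: le_trans; rewrite ler_wpM2r ?expR_ge0//.
by rewrite -/L mulrA ler_wpM2r ?expR_ge0// ler_peMr.
Qed.

End Construction.

(** * Relative error of the mixture on the covered range *)

Section Inside.
Variables (R : realType) (r : nat) (a : 'I_r.+1 -> R).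
Implicit Types (v x u t b C K gam beta : R) (f : R -> R).

Local Notation L v := (10 * r.+2%:R * v).
Local Notation X v := (rad r v + r.+3%:R).

Lemma window_le v : 1 <= v -> X v <= L v.
Proof.
move=> v1; rewrite /rad.
have -> : L v = 8 * r.+2%:R * v + 2 * r.+2%:R * v by ring.
rewrite lerD2l; apply: (@le_trans _ _ (2 * r.+2%:R * 1)).
  by rewrite mulr1 -natrM ler_nat; lia.
by rewrite ler_wpM2l// mulr_ge0.
Qed.

Lemma in_window v u (i : 'I_r.+1) : `|u| <= rad r v + 2 -> `|u + i%:R * sig v| <= X v.
Proof.
move=> ur; apply: le_trans (ler_normD _ _) _.
have -> : X v = rad r v + 2 + r.+1%:R.
  by rewrite -addrA; congr (_ + _); rewrite -natrD.
rewrite lerD// normrM normr_nat (gtr0_norm (sig_gt0 v)).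
apply: (@le_trans _ _ (i%:R * 1)); first by rewrite ler_wpM2l// sig_le1.
by rewrite mulr1 ler_nat ltnW.
Qed.

Definition lratio f x t : R := expR (ln (f (x + t)) - ln (f x)).

Lemma lratioE f x t : (forall x, 0 < f x) -> f (x + t) = f x * lratio f x t.
Proof.
move=> f0; rewrite /lratio expRB !lnK ?posrE//.
by rewrite mulrC divfK// gt_eqF.
Qed.

(** As [b <= 1], the single rate [exp (- b v ^ 2)] bounds both [sig v] and [sig v ^ beta] for every
    [beta >= b]; this gives a threshold uniform in [beta]. *)
Lemma tame_eventually gam C b : 0 < gam -> 1 <= C -> 0 < b <= 1 ->
  exists2 v0 : R, 1 <= v0 & forall v beta, v0 <= v -> b <= beta ->
    tame r gam beta C (sig v) (X v).
Proof.
move=> g0 C1 /andP[b0 b1]; pose K : R := r.+1%:R * C + 2 * C.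
have C0 : 0 <= C by lra.
have rC : 0 <= r.+1%:R * C by rewrite mulr_ge0.
have rC1 : C <= r.+1%:R * C by rewrite ler_peMl// (ler_nat R 1).
have K0 : 0 <= K by rewrite /K; lra.
have m0 : 0 < Num.min 1 gam by rewrite lt_min ltr01.
have [v0 v01 H] := eventually_small r K0 b0 m0.
exists v0 => // v beta vv0 bb; have v1 := le_trans v01 vv0.
have := H v vv0; rewrite le_min => /andP[H1 H2].
have s0 := sig_gt0 v; have s1 := sig_le1 v.
have sq : 0 <= v ^+ 2 by exact: sqr_ge0.
have st : sig v <= expR (- b * v ^+ 2) by rewrite /sig ler_expR; nra.
have sb : sig v `^ beta <= expR (- b * v ^+ 2) by rewrite sig_powR ler_expR; nra.
have EK (c : R) : 0 <= c -> c * C <= K -> c * (C * expR (C * X v)) <= K * expR (K * L v).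
  move=> c0 cK; rewrite [leLHS]mulrA; apply: ler_pM => //; rewrite ?expR_ge0 ?mulr_ge0//.
  rewrite ler_expR; apply: ler_pM => //.
  - by rewrite addr_ge0// (le_trans _ (rad_ge r v1))//; lra.
  - by rewrite /K; lra.
  - exact: window_le.
have KE0 : 0 <= K * expR (K * L v) by rewrite mulr_ge0 ?expR_ge0.
split; first by rewrite s0.
- apply: le_trans H1; rewrite ler_pM ?(ltW s0) ?mulr_ge0 ?expR_ge0//.
  by apply: EK => //; rewrite /K; lra.
- apply: le_trans H2; rewrite ler_pM ?(ltW s0) ?mulr_ge0 ?expR_ge0//.
  by apply: EK => //; rewrite /K; lra.
- apply: le_trans H1; rewrite ler_pM ?powR_ge0 ?mulr_ge0 ?expR_ge0//.
  by rewrite -[leLHS]mul1r; apply: EK => //; rewrite /K; lra.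
Qed.

Lemma fine_eventually : exists2 v0 : R, 1 <= v0 & forall v, v0 <= v ->
  16 * (scl r v)%:R * sig v <= 1.
Proof.
pose K : R := 16 * r.+4%:R.
have K2 : 2 <= K by rewrite /K -natrM (ler_nat R 2); lia.
have K0 : 0 <= K by lra.
have [v0 v01 H] := eventually_small r K0 (@ltr01 R) (@ltr01 R).
exists v0 => // v vv0; have v1 := le_trans v01 vv0; have v_0 : 0 <= v by lra.
apply: le_trans (H v vv0); rewrite mulN1r -/(sig v) ler_wpM2r ?(ltW (sig_gt0 v))//.
have [_ sb] := scl_bounds r v1.
apply: (@le_trans _ _ (K * v ^+ 2)).
  by rewrite /K -mulrA ler_wpM2l.
rewrite ler_wpM2l//; apply: (@le_trans _ _ (expR v ^+ 2)).
  rewrite lerXn2r ?nnegrE ?expR_ge0//.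
  by apply: le_trans (expR_ge1Dx _); rewrite lerDr.
rewrite -expRM_natl ler_expR ler_pM// ler_peMl//.
by rewrite -natrM (ler_nat R 1).
Qed.

(** Positivity of the weights in spite of negative [a i]: since the [a i] sum to 1, [wt / f - 1] is
    a combination of relative variations of [f] over shifts [i sigma], all small. *)
Lemma weights_eventually C' b : \sum_i a i = 1 -> 1 <= C' -> 0 < b <= 1 ->
  exists2 v0 : R, 1 <= v0 & forall v beta f u (q : {poly R}), v0 <= v ->
    b <= beta <= r.+1%:R -> (forall x, 0 < f x) -> `|u| <= rad r v + 2 ->
    (size q <= r.+1)%N -> q`_0 = 1 -> (forall j, `|q`_j| <= ew C' u) ->
    (forall t, `|u + t| <= X v -> `|lratio f u t - q.[t]| <=
      ew C' u * (`|t| `^ beta * expR (C' * (`|t| / sig v)))) ->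
    f u / 2 <= wt a v f u <= 2 * f u.
Proof.
move=> asum C1 /andP[b0 b1].
pose P : R := r.+1%:R ^+ r.+1; pose Kr : R := P * (expR (C' * r.+1%:R) + r%:R).
pose A : R := \sum_i `|a i|; pose K : R := A * C' * Kr + C'.
have C0 : 0 <= C' by lra.
have P0 : 0 <= P by rewrite exprn_ge0.
have Kr0 : 0 <= Kr by rewrite mulr_ge0// addr_ge0// expR_ge0.
have A0 : 0 <= A by apply: sumr_ge0.
have AK0 : 0 <= A * C' * Kr by rewrite !mulr_ge0.
have K0 : 0 <= K by rewrite /K; lra.
have h2 : 0 < 2^-1 :> R by rewrite invr_gt0.
have [v0 v01 H] := eventually_small r K0 b0 h2.
exists v0 => // v beta f u q vv0 /andP[bb br] f0 ur sq q0 qB FE.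
have v1 := le_trans v01 vv0; have v_0 : 0 <= v by lra.
have s0 := sig_gt0 v; have s1 := sig_le1 v.
have sq0 : 0 <= v ^+ 2 by exact: sqr_ge0.
set tau := expR (- b * v ^+ 2) in H.
have st : sig v <= tau by rewrite /sig ler_expR; nra.
have sb : sig v `^ beta <= tau by rewrite sig_powR ler_expR; nra.
have t0 : 0 <= tau by exact: expR_ge0.
have beta0 : 0 <= beta by lra.
set B := ew C' u in qB FE.
have B0 : 0 <= B by exact: ew_ge0.
have r1 : 1 <= r.+1%:R :> R by rewrite (ler_nat R 1).
have dev (i : 'I_r.+1) : `|lratio f u (i%:R * sig v) - 1| <= B * Kr * tau.
  have ir : i%:R <= r.+1%:R :> R by rewrite ler_nat ltnW.
  have iw := in_window i ur.
  have tn : `|i%:R * sig v| = i%:R * sig v by rewrite ger0_norm// mulr_ge0// ltW.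
  have := FE _ iw; rewrite tn mulfK ?gt_eqF// => F1.
  have E1 : (i%:R * sig v) `^ beta <= P * tau.
    rewrite powRM ?(ltW s0)// ler_pM ?powR_ge0//.
    apply: (@le_trans _ _ (r.+1%:R `^ beta)); first by rewrite ge0_ler_powR ?nnegrE.
    by rewrite /P -powR_mulrn// ler_powR.
  have E2 : expR (C' * i%:R) <= expR (C' * r.+1%:R) by rewrite ler_expR ler_wpM2l.
  have F2 : `|lratio f u (i%:R * sig v) - q.[i%:R * sig v]| <=
      B * (P * tau * expR (C' * r.+1%:R)).
    apply: le_trans F1 _; rewrite ler_wpM2l// ler_pM ?powR_ge0 ?expR_ge0//.
  have F3 : `|q.[i%:R * sig v] - 1| <= r%:R * (B * (P * tau)).
    rewrite (horner_coef_wide _ sq) big_ord_recl q0 expr0 mulr1 addrAC subrr add0r.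
    apply: le_trans (ler_norm_sum _ _ _) _.
    apply: (@le_trans _ _ (\sum_(j < r) B * (P * tau))); last first.
      by rewrite sumr_const card_ord mulr_natl.
    apply: ler_sum => j _; rewrite normrM ler_pM// normrX tn exprMn ler_pM ?exprn_ge0 ?(ltW s0)//.
      apply: (@le_trans _ _ (r.+1%:R ^+ lift ord0 j)); first by apply: lerXn2r; rewrite ?nnegrE.
      by rewrite /P ler_weXn2l// lift0 ltnS ltnW.
    apply: le_trans st; rewrite lift0 exprS ler_piMr ?(ltW s0)//.
    by rewrite exprn_ile1// ltW.
  apply: le_trans (ler_distD q.[i%:R * sig v] _ _) _.
  apply: le_trans (lerD F2 F3) _; rewrite /Kr.
  by rewrite le_eqVlt; apply/orP; left; apply/eqP; ring.
have E : wt a v f u = f u * (1 + \sum_i a i * (lratio f u (i%:R * sig v) - 1)).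
  have -> : 1 + \sum_i a i * (lratio f u (i%:R * sig v) - 1) =
      \sum_i a i * lratio f u (i%:R * sig v).
    rewrite -{1}asum -big_split/=; apply: eq_bigr => i _; ring.
  rewrite /wt mulr_sumr; apply: eq_bigr => i _.
  by rewrite (lratioE _ _ f0); ring.
have S : `|\sum_i a i * (lratio f u (i%:R * sig v) - 1)| <= 2^-1.
  apply: le_trans (ler_norm_sum _ _ _) _.
  apply: (@le_trans _ _ (\sum_i `|a i| * (B * Kr * tau))).
    by apply: ler_sum => i _; rewrite normrM ler_wpM2l.
  rewrite -mulr_suml -/A; apply: le_trans (H v vv0).
  have uX : `|u| <= L v.
    apply: le_trans ur (le_trans _ (window_le v1)).
    by rewrite lerD2l (ler_nat R 2).
  have -> : A * (B * Kr * tau) = A * Kr * B * tau by ring.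
  rewrite ler_wpM2r// (@le_trans _ _ (A * Kr * (C' * expR (C' * L v))))//.
    by rewrite ler_wpM2l ?mulr_ge0// ew_le_cst.
  have -> : A * Kr * (C' * expR (C' * L v)) = A * C' * Kr * expR (C' * L v) by ring.
  rewrite ler_pM ?expR_ge0//; first by rewrite /K; lra.
  by rewrite ler_expR ler_wpM2r ?mulr_ge0// /K; lra.
move: S; rewrite ler_norml E => /andP[S1 S2]; have fu := f0 u.
apply/andP; split; last by rewrite mulrC ler_wpM2r ?(ltW fu)//; lra.
by rewrite ler_wpM2l ?(ltW fu)//; lra.
Qed.

Lemma inside gam C b : \sum_i a i = 1 ->
  (forall j, (j <= r)%N -> gmean (\sum_i a i *: ('X + (i%:R)%:P) ^+ j) (j == 0%N)%:R) ->
  0 < gam -> 1 <= C -> 0 < b <= 1 ->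
  exists K : R, exists v0 : R, [/\ 0 <= K, 1 <= v0 & forall v beta f, v0 <= v ->
    r%:R < beta <= r.+1%:R -> b <= beta -> regular r gam beta C (fun x => ln (f x)) ->
    (forall x, 0 < f x) ->
    [/\ 16 * (scl r v)%:R * sig v <= 1,
        (forall u, `|u| <= rad r v + 2 -> f u / 2 <= wt a v f u <= 2 * f u),
        (forall x, `|x| <= rad r v ->
          `|mixsum a v f x / f x - kap r v| <= ew K x * sig v `^ beta) &
        (forall x, `|x| <= rad r v -> ew K x * sig v `^ beta <= 8^-1)]].
Proof.
move=> asum aP g0 C1 b01; have [C' C'1 ratio] := ratio_expansion r g0 C1.
have C'0 : 0 <= C' by lra.
have [Kd [sd [Kd0 disc]]] := disc_expansion C'0 aP.
have [Cp [sp [Cp0 phase_le]]] := gsum_phase R.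
have [v1 v11 tm] := tame_eventually g0 C1 b01.
have [v2 v21 fine] := fine_eventually.
have [v3 v31 wts] := weights_eventually asum C'1 b01.
(* [2 Kd C'] is the discretisation error and [Cp] the change of phase; [C' + 1] lets the rate [K]
   dominate the rates [C'] and 1. *)
pose K : R := 2 * Kd * C' + Cp + C' + 1.
have KdC : 0 <= Kd * C' by rewrite mulr_ge0.
have K0 : 0 <= K by rewrite /K; lra.
have C'K : C' <= K by rewrite /K; lra.
have K1 : 1 <= K by rewrite lerDr !addr_ge0// -mulrA mulr_ge0.
have h8 : 0 < 8^-1 :> R by rewrite invr_gt0.
have /andP[b0 b1] := b01.
have [v4 v41 H4] := eventually_small r K0 b0 h8.
exists K, (v1 + v2 + v3 + v4 + (maxn sd sp)%:R).
have m0 : 0 <= (maxn sd sp)%:R :> R by [].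
split=> //.
  by move: v11 v21 v31 v41 m0; clear; lra.
move=> v beta f vv0 /andP[rb br] bb reg f0.
have [vm v_1 [vv1 vv2 vv3 vv4]] :
    [/\ (maxn sd sp)%:R <= v, 1 <= v & [/\ v1 <= v, v2 <= v, v3 <= v & v4 <= v]].
  by move: vv0 v11 v21 v31 v41 m0; clear; move=> *; split; [..|split]; lra.
clear vv0.
have v_0 : 0 <= v by exact: le_trans v_1.
have s0 := sig_gt0 v; have s1 := sig_le1 v.
have sm : (maxn sd sp <= scl r v)%N.
  rewrite -(ler_nat R); apply: le_trans vm _; have [sb _] := scl_bounds r v_1.
  apply: le_trans sb; rewrite -[leLHS]mul1r ler_pM//.
    by rewrite (ler_nat R 1).
  by rewrite expr2 ler_peMr.
move: sm; rewrite geq_max => /andP[sds sps].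
have tmv := tm v beta vv1 bb.
have finev := fine v vv2.
have rbr : r%:R < beta <= r.+1%:R by rewrite rb.
have bbr : b <= beta <= r.+1%:R by rewrite bb.
have beta0 : 0 < beta <= r.+1%:R by rewrite br (lt_le_trans b0 bb).
have ratiov x := @ratio beta (fun x => ln (f x)) (sig v) (X v) rbr reg tmv x.
have sq0 : 0 <= v ^+ 2 by exact: sqr_ge0.
(* The choice of [scl] leaves a spare factor [sig v], which pays for the phase shift [x / sig v]. *)
have es : expR (- (scl r v)%:R) <= sig v * sig v `^ beta.
  have [sb _] := scl_bounds r v_1.
  rewrite sig_powR /sig -expRD ler_expR.
  have -> : - v ^+ 2 + - beta * v ^+ 2 = - ((beta + 1) * v ^+ 2) by ring.
  rewrite lerN2; apply: le_trans sb; rewrite ler_wpM2r//.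
  by apply: le_trans (lerD br (lexx 1)) _; rewrite natr1 ler_nat.
have sbeta0 : 0 <= sig v `^ beta by exact: powR_ge0.
split=> //.
- move=> u ur; have uX : `|u| <= X v.
    by apply: le_trans ur _; rewrite lerD2l (ler_nat R 2).
  have [q [sq q0 qB qE]] := ratiov u uX.
  exact: (@wts v beta f u q).
- move=> x xr; have xX : `|x| <= X v by apply: le_trans xr _; rewrite lerDl.
  have [q [sq q0 qB qE]] := ratiov x xX.
  have cv := covers_phase v_1 finev xr.
  have c0 : `|0 : R| <= rad r v.
    by rewrite normr0; apply: le_trans (rad_ge r v_1); exact: le_trans v_1.
  have cv0 := covers_phase v_1 finev c0.
  have B0 : 0 <= ew C' x by exact: ew_ge0.
  have s01 : 0 < sig v <= 1 by rewrite s0.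
  have := @disc (scl r v) (2 * half r v).+1 (phase r v x) beta (sig v) q (ew C' x)
    (lratio f x) sds cv beta0 s01 B0 sq q0 qB.
  set S := \sum_(k < _) _; move=> D1.
  have SE : mixsum a v f x / f x = S.
    rewrite /mixsum /S mulr_suml; apply: eq_bigr => k _.
    rewrite node_phase -mulrA; congr (_ * _); rewrite mulrAC; congr (_ * _).
    rewrite /wt mulr_suml; apply: eq_bigr => i _.
    rewrite -(node_at r v x k) -addrA.
    have -> : sig v * (phase r v x + k%:R * lat R (scl r v)) + i%:R * sig v =
      sig v * (phase r v x + k%:R * lat R (scl r v) + i%:R) by ring.
    by rewrite (lratioE _ _ f0); field; rewrite gt_eqF.
  have {}D1 : `|S - gsum (lat R (scl r v)) (2 * half r v).+1 1 (phase r v x)| <=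
      Kd * ew C' x * (expR (- (scl r v)%:R) + sig v `^ beta).
    apply: D1 => k i /=; apply: qE; rewrite mulrDr addrA node_at.
    by rewrite [sig v * _]mulrC; apply: in_window; exact: node_bound.
  have P1 := @phase_le (scl r v) (2 * half r v).+1 _ _ sps cv0 cv.
  have kE : kap r v = gsum (lat R (scl r v)) (2 * half r v).+1 1 (phase r v 0).
    by rewrite /kap /phase mul0r subr0.
  rewrite -kE in P1.
  have pE : `|phase r v x - phase r v 0| = `|x| / sig v.
    rewrite /phase mul0r subr0 addrAC subrr add0r normrN normrM normfV.
    by rewrite (gtr0_norm s0).
  rewrite pE in P1.
  have x1 : `|x| <= expR `|x| by apply: le_trans (expR_ge1Dx _); rewrite lerDr.
  have P2 : Cp * expR (- (scl r v)%:R) * (`|x| / sig v) <= Cp * (sig v `^ beta * expR `|x|).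
    rewrite -mulrA ler_wpM2l// mulrA ler_pdivrMr//.
    have -> : sig v `^ beta * expR `|x| * sig v = sig v * sig v `^ beta * expR `|x| by ring.
    by rewrite ler_pM ?expR_ge0.
  have D2 : Kd * ew C' x * (expR (- (scl r v)%:R) + sig v `^ beta) <=
      2 * Kd * ew C' x * sig v `^ beta.
    have : expR (- (scl r v)%:R) <= sig v `^ beta.
      by apply: le_trans es _; rewrite ler_piMl.
    have KB : 0 <= Kd * ew C' x by rewrite mulr_ge0.
    move=> /(ler_wpM2l KB) e1.
    have -> : 2 * Kd * ew C' x * sig v `^ beta =
      Kd * ew C' x * sig v `^ beta + Kd * ew C' x * sig v `^ beta by ring.
    by rewrite mulrDr lerD2r.
  rewrite SE; apply: le_trans (ler_distD
    (gsum (lat R (scl r v)) (2 * half r v).+1 1 (phase r v x)) _ _) _.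
  apply: le_trans (lerD (le_trans D1 D2) (le_trans P1 P2)) _.
  have -> : 2 * Kd * ew C' x * sig v `^ beta + Cp * (sig v `^ beta * expR `|x|) =
    (2 * Kd * ew C' x + Cp * expR `|x|) * sig v `^ beta by ring.
  rewrite ler_wpM2r// /ew.
  have E1 : expR (C' * `|x|) <= expR (K * `|x|).
    by rewrite ler_expR ler_wpM2r.
  have E2 : expR `|x| <= expR (K * `|x|).
    by rewrite ler_expR ler_peMl.
  have E3 : 0 <= (C' + 1) * expR (K * `|x|) by rewrite mulr_ge0 ?expR_ge0// addr_ge0.
  set e1 := expR (C' * _) in E1 *; set e2 := expR `|x| in E2 *; set e := expR (K * _) in E1 E2 E3 *.
  have -> : K * e = Kd * C' * e + Kd * C' * e + Cp * e + (C' + 1) * e by rewrite /K; ring.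
  have -> : 2 * Kd * (C' * e1) + Cp * e2 = Kd * C' * e1 + Kd * C' * e1 + Cp * e2 by ring.
  by rewrite ler_wpDr// !lerD// ler_wpM2l.
- move=> x xr; apply: le_trans (H4 v vv4).
  rewrite ler_pM ?ew_ge0//.
    apply: ew_le_cst => //; apply: le_trans xr (le_trans _ (window_le v_1)).
    by rewrite lerDl.
  by rewrite sig_powR ler_expR !mulNr lerN2 ler_wpM2r.
Qed.

End Inside.

(** * Pointwise bound on the divergence integrand *)

Section Pointwise.
Variables (R : realType) (r : nat) (a : 'I_r.+1 -> R).
Implicit Types (v x u t b C K gam beta : R) (f : R -> R).

Definition approx v f x : R := mixsum a v f x / kap r v.

Definition relent f g x : R := f x * ln (f x / g x) + g x - f x.

Lemma psi_le x : psi x <= expR (- x ^+ 2).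
Proof.
rewrite /psi ler_piMl ?expR_ge0// invf_le1 ?sqrtr_gt0 ?pi_gt0//.
by rewrite -[leLHS]sqrtr1 ler_sqrt ?pi_gt0// (le_trans _ (pi_ge2 R))// (ler_nat R 1 2).
Qed.

(** [ln (y / z) <= y / z - 1] turns the left side into the chi-square integrand
    [(z - y) ^ 2 / z]. *)
Lemma relent_quadratic (y z e : R) : 0 < y -> 0 < z -> `|z / y - 1| <= e -> e <= 2^-1 ->
  y * ln (y / z) + z - y <= 2 * y * e ^+ 2.
Proof.
move=> y0 z0; set rho := z / y - 1 => re e2.
have w0 : 0 < z / y by rewrite divr_gt0.
have w2 : 2^-1 <= z / y by move: re; rewrite ler_norml /rho => /andP[? ?]; lra.
have ln_le : ln (y / z) <= y / z - 1.
  have -> : y / z = 1 + (y / z - 1) by lra.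
  rewrite [leRHS](_ : _ = y / z - 1); last by lra.
  by apply: le_ln1Dx; have := divr_gt0 y0 z0; lra.
have h1 : y * ln (y / z) + z - y <= y * (y / z - 1) + z - y.
  by rewrite -!addrA lerD2r ler_wpM2l// ltW.
apply: le_trans h1 _.
have -> : y * (y / z - 1) + z - y = y * (rho ^+ 2 / (z / y)).
  by rewrite /rho; field; rewrite !gt_eqF.
rewrite [leLHS]mulrA ler_pdivrMr//.
have re2 : rho ^+ 2 <= e ^+ 2.
  rewrite -(real_normK (num_real rho)) lerXn2r ?nnegrE//.
  exact: le_trans re.
have h2 := ler_wpM2l (ltW y0) re2.
have h3 : 0 <= y * e ^+ 2 by rewrite mulr_ge0 ?sqr_ge0// ltW.
by have := ler_wpM2l h3 w2; lra.
Qed.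

(** With [x = u - sigma z], [x ^ 2 <= 3 (u ^ 2 + z ^ 2 / 2)]: the decay of [f] at the node and half
    of the kernel exponent give the decay in [x]; the other half is summed. *)
Lemma mixsum_upper v f M x : 1 <= v -> 0 < M -> (forall x, f x <= M * psi x) ->
  (forall u, `|u| <= rad r v + 2 -> wt a v f u <= 2 * f u) ->
  mixsum a v f x <= 2 * M * sumC 0 * expR (- (x ^+ 2 / 3)).
Proof.
move=> v1 M0 fM wf; have l01 := @lat_bounds R (scl r v) isT.
have l0 := lat_scl_gt0 r v.
apply: (@le_trans _ _ (\sum_(k < (2 * half r v).+1) 2 * M * expR (- (x ^+ 2 / 3)) *
    (lat R (scl r v) * expR (0 * `|phase r v x + k%:R * lat R (scl r v)| -
       (phase r v x + k%:R * lat R (scl r v)) ^+ 2 / 2)))); last first.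
  rewrite -mulr_sumr [leRHS]mulrAC ler_wpM2l ?lattice_gauss_le//.
  by rewrite !mulr_ge0 ?expR_ge0// ltW.
apply: ler_sum => k _; rewrite [leRHS]mulrCA ler_wpM2l ?(ltW l0)//.
rewrite -node_phase; set z := _ / sig v; set u := node r v k.
have xE : x = u - sig v * z by rewrite /z /u; field; rewrite gt_eqF ?sig_gt0.
have fu : wt a v f u <= 2 * M * expR (- u ^+ 2).
  apply: le_trans (wf u _) _; first exact: node_bound.
  rewrite -mulrA ler_wpM2l//; apply: le_trans (fM u) _.
  by rewrite ler_wpM2l ?psi_le// ltW.
apply: (@le_trans _ _ (2 * M * expR (- u ^+ 2) * gauss_fun z)).
  by rewrite ler_wpM2r ?gauss_fun_ge0.
rewrite -[leLHS]mulrA -[leRHS]mulrA ler_wpM2l ?mulr_ge0 ?(ltW M0)//.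
rewrite /gauss_fun -!expRD ler_expR.
have s0 := sig_gt0 v; have s1 := sig_le1 v.
have : x ^+ 2 <= 3 * (u ^+ 2 + z ^+ 2 / 2).
  have sz : (sig v * z) ^+ 2 <= z ^+ 2.
    by rewrite exprMn ler_piMl ?sqr_ge0// exprn_ile1// ltW.
  rewrite {1}xE; have := sqr_ge0 (u * 2 + sig v * z); lra.
rewrite mul0r; lra.
Qed.

Lemma mixsum_terms_ge0 v f x : (forall u, 0 < f u) -> 1 <= v ->
  (forall u, `|u| <= rad r v + 2 -> f u / 2 <= wt a v f u) ->
  forall k : 'I_(2 * half r v).+1,
  0 <= lat R (scl r v) * (wt a v f (node r v k) * gauss_fun ((node r v k - x) / sig v)).
Proof.
move=> f0 v1 wf k; rewrite mulr_ge0 ?(ltW (lat_scl_gt0 r v))// mulr_ge0 ?gauss_fun_ge0//.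
apply: le_trans (wf _ _); last exact: node_bound.
by rewrite divr_ge0// ltW.
Qed.

(** Only the central node, at [0], is kept. So small a bound suffices because only its logarithm
    enters the divergence, at a cost of order [x ^ 2 / sigma ^ 2], and only where [f] is a high
    power of [sigma]. *)
Lemma mixsum_lower v f xi x : (forall u, 0 < f u) -> 1 <= v ->
  16 * (scl r v)%:R * sig v <= 1 -> xi <= f 0 -> 0 < xi ->
  (forall u, `|u| <= rad r v + 2 -> f u / 2 <= wt a v f u) ->
  sig v * (xi / 2) * expR (- (x / sig v) ^+ 2) <= mixsum a v f x.
Proof.
move=> f0 v1 fine xf xi0 wf.
have hh : (half r v < (2 * half r v).+1)%N by lia.
rewrite /mixsum (bigD1 (Ordinal hh))//= ler_wpDr//.
  by apply: sumr_ge0 => k _; exact: mixsum_terms_ge0.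
have n0 : node r v (half r v) = 0 by rewrite /node subrr mul0r.
rewrite n0 sub0r mulNr /gauss_fun sqrrN -mulrA ler_pM//.
- exact/ltW/sig_gt0.
- by rewrite mulr_ge0 ?expR_ge0// divr_ge0// ltW.
- exact: sig_le_lat.
- rewrite ler_wpM2r ?expR_ge0//.
  apply: le_trans (wf 0 _); first by rewrite ler_wpM2r.
  rewrite normr0 addr_ge0//; apply: le_trans (rad_ge r v1); lra.
Qed.

Lemma pointwise gam C b M xi : \sum_i a i = 1 ->
  (forall j, (j <= r)%N -> gmean (\sum_i a i *: ('X + (i%:R)%:P) ^+ j) (j == 0%N)%:R) ->
  0 < gam -> 1 <= C -> 0 < b <= 1 -> 0 < M -> 0 < xi ->
  exists K : R, exists v0 : R, [/\ 0 <= K, 1 <= v0 & forall v beta f, v0 <= v ->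
    r%:R < beta <= r.+1%:R -> b <= beta -> regular r gam beta C (fun x => ln (f x)) ->
    (forall x, 0 < f x) -> (forall x, f x <= M * psi x) -> xi <= f 0 ->
    [/\ 16 * (scl r v)%:R * sig v <= 1,
        (forall k : 'I_(2 * half r v).+1, 0 < wt a v f (node r v k)),
        (forall x, 0 < approx v f x) &
        (forall x, relent f (approx v f) x <=
           K * sig v `^ (2 * beta) * expR (- (x ^+ 2 / 16)))]].
Proof.
move=> asum aP g0 C1 b01 M0 xi0.
have [K1 [v0 [K10 v01 H]]] := inside asum aP g0 C1 b01.
(* [32 = 2 * 4 ^ 2], the error being [4 e] after division by [kap >= 1 / 4]. Of [exp (- x ^ 2)], the
   share 15/16 absorbs [exp (2 K1 |x|)], and 1/16 is left for integration. *)
pose Kin : R := 32 * M * K1 ^+ 2 * expR ((2 * K1) ^+ 2 / (4 * (15 / 16))).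
pose S0 : R := sumC 0; have S00 : 0 < S0 by exact: sumC_gt0.
(* The constant of the lower bound on the mixture, put into an exponent by [k0 <= exp k0]. *)
pose k0 : R := M * (2 * S0) / xi.
have k00 : 0 < k0 by rewrite divr_gt0// !mulr_gt0.
pose Kout : R := 3 / 2 * M * (k0 + 2) + 8 * M * S0.
have MS0 : 0 < M * S0 by rewrite mulr_gt0.
have Mk0 : 0 < M * (k0 + 2) by rewrite mulr_gt0//; lra.
have Kin0 : 0 <= Kin.
  by rewrite /Kin !mulr_ge0 ?sqr_ge0 ?expR_ge0// ltW.
have Kout0 : 0 <= Kout by rewrite /Kout; lra.
exists (Kin + Kout), v0; split=> //; first exact: addr_ge0.
move=> v beta f vv0 rbr bb reg f0 fM xf.
have [fine wf mf sm] := H v beta f vv0 rbr bb reg f0.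
have v1 : 1 <= v by exact: le_trans vv0.
have s0 := sig_gt0 v; have s1 := sig_le1 v.
have wf1 u : `|u| <= rad r v + 2 -> f u / 2 <= wt a v f u by move=> /wf /andP[].
have wf2 u : `|u| <= rad r v + 2 -> wt a v f u <= 2 * f u by move=> /wf /andP[].
have /andP[ka kb] := kap_bounds r v1.
have k4 : 0 < kap r v by apply: lt_le_trans ka; rewrite invr_gt0.
have low x := @mixsum_lower v f xi x f0 v1 fine xf xi0 wf1.
have up x := @mixsum_upper v f M x v1 M0 fM wf2.
have m0 x : 0 < mixsum a v f x.
  by apply: lt_le_trans (low x); rewrite !mulr_gt0 ?expR_gt0// ?invr_gt0.
have a0 x : 0 < approx v f x by rewrite divr_gt0.
split=> // [k|x].
  apply: lt_le_trans (wf1 _ _); first by rewrite divr_gt0.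
  exact: node_bound.
have fe : f x <= M * expR (- x ^+ 2).
  by apply: le_trans (fM x) _; rewrite ler_wpM2l ?psi_le// ltW.
set E := expR (- (x ^+ 2 / 16)); have E0 : 0 <= E by exact: expR_ge0.
set T := sig v `^ (2 * beta); have T0 : 0 <= T by exact: powR_ge0.
have [xr|xr] := leP `|x| (rad r v).
  apply: (@le_trans _ _ (Kin * T * E)); last first.
    by rewrite ler_wpM2r// ler_wpM2r// lerDl.
  set e := ew K1 x * sig v `^ beta.
  have e0 : 0 <= e by rewrite mulr_ge0 ?ew_ge0 ?powR_ge0.
  have rho : `|approx v f x / f x - 1| <= 4 * e.
    have -> : approx v f x / f x - 1 = (mixsum a v f x / f x - kap r v) / kap r v.
      by rewrite /approx; field; rewrite !gt_eqF.
    rewrite normrM normfV (gtr0_norm k4) ler_pdivrMr//.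
    apply: le_trans (mf x xr) _; rewrite -/e.
    by move: (ler_wpM2l e0 ka); clear; lra.
  have e2 : 4 * e <= 2^-1 by move: (sm x xr); rewrite -/e; clear; lra.
  apply: le_trans (relent_quadratic (f0 x) (a0 x) rho e2) _.
  have TE : sig v `^ beta * sig v `^ beta = T.
    by rewrite /T !sig_powR -expRD; congr expR; ring.
  have eE : e ^+ 2 = K1 ^+ 2 * expR (2 * K1 * `|x|) * T.
    have -> : 2 * K1 * `|x| = K1 * `|x| + K1 * `|x| by ring.
    by rewrite /e /ew expRD -TE; ring.
  have -> : 2 * f x * (4 * e) ^+ 2 = f x * (32 * K1 ^+ 2 * T * expR (2 * K1 * `|x|)).
    by rewrite exprMn eE; ring.
  set G := expR _.
  apply: (@le_trans _ _ (M * expR (- x ^+ 2) * (32 * K1 ^+ 2 * T * G))).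
    by rewrite ler_wpM2r// !mulr_ge0 ?sqr_ge0// expR_ge0.
  have GE : G * expR (- x ^+ 2) <= expR ((2 * K1) ^+ 2 / (4 * (15 / 16))) * E.
    have := @expR_lin_quad R (2 * K1) (15 / 16) `|x|.
    rewrite real_normK ?num_real// => /(_ _)Q.
    rewrite /G -expRD; have -> : 2 * K1 * `|x| + - x ^+ 2 =
      2 * K1 * `|x| - 15 / 16 * x ^+ 2 + - (x ^+ 2 / 16) by clear; lra.
    by rewrite expRD ler_wpM2r// Q//; lra.
  have c0 : 0 <= 32 * M * K1 ^+ 2 * T by rewrite !mulr_ge0 ?sqr_ge0// ltW.
  by move: (ler_wpM2l c0 GE); rewrite /Kin; clear; lra.
apply: (@le_trans _ _ (Kout * T * E)); last first.
  by rewrite ler_wpM2r// ler_wpM2r// lerDr.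
have rv := rad_ge r v1.
have vx : v <= `|x| by exact: le_trans rv (ltW xr).
have x2 : `|x| ^+ 2 = x ^+ 2 by rewrite real_normK ?num_real.
have v0' : 0 <= v by exact: le_trans v1.
have v2 : 1 <= v ^+ 2 by rewrite exprn_ege1.
have vx2 : v ^+ 2 <= x ^+ 2 by rewrite -x2 lerXn2r ?nnegrE.
have xs2 : x ^+ 2 <= (x / sig v) ^+ 2.
  by rewrite expr_div_n ler_pdivlMr ?exprn_gt0// ler_piMr ?sqr_ge0// exprn_ile1// ltW.
set y2 := (x / sig v) ^+ 2 in xs2.
have ratio : f x / approx v f x <= expR (k0 + v ^+ 2 + y2).
  rewrite ler_pdivrMr//.
  apply: (@le_trans _ _ M).
    apply: le_trans fe _; rewrite ler_piMr ?(ltW M0)//.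
    by rewrite -[leRHS]expR0 ler_expR oppr_le0 sqr_ge0.
  have lw : sig v * (xi / 2) * expR (- y2) / S0 <= approx v f x.
    apply: (@le_trans _ _ (mixsum a v f x / S0)).
      by rewrite ler_wpM2r ?low// invr_ge0 ltW.
    by rewrite /approx ler_wpM2l ?(ltW (m0 x))// lef_pV2.
  apply: le_trans (ler_wpM2l (expR_ge0 _) lw).
  rewrite !expRD /sig.
  have -> : expR k0 * expR (v ^+ 2) * expR y2 * (expR (- v ^+ 2) * (xi / 2) * expR (- y2) / S0) =
    expR k0 * (expR (v ^+ 2) * expR (- v ^+ 2)) * (expR y2 * expR (- y2)) * (xi / (2 * S0)).
    by field; rewrite gt_eqF.
  rewrite !expRxMexpNx_1 !mulr1.
  rewrite -ler_pdivrMr ?divr_gt0 ?mulr_gt0//.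
  have -> : M / (xi / (2 * S0)) = k0 by rewrite /k0; field; rewrite !gt_eqF.
  by apply: le_trans (expR_ge1Dx _); rewrite lerDr.
have lnr : ln (f x / approx v f x) <= (k0 + 2) * y2.
  apply: (@le_trans _ _ (k0 + v ^+ 2 + y2)).
    by rewrite -[leRHS]expRK ler_ln ?posrE ?expR_gt0 ?divr_gt0.
  have y21 : 1 <= y2 by exact: le_trans v2 (le_trans vx2 xs2).
  by move: (ler_wpM2l (ltW k00) y21) (le_trans vx2 xs2); clear; lra.
set U := expR (- (x ^+ 2 / 3)).
have U0 : 0 <= U by exact: expR_ge0.
set W := (sig v ^+ 2)^-1.
have W1 : 1 <= W by rewrite invf_ge1 ?exprn_gt0// exprn_ile1// ltW.
have yW : y2 = x ^+ 2 * W by rewrite /y2 expr_div_n.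
have xU : x ^+ 2 * expR (- x ^+ 2) <= 3 / 2 * U.
  have -> : - x ^+ 2 = - (2 * x ^+ 2 / 3) + - (x ^+ 2 / 3) by clear; lra.
  rewrite expRD mulrA ler_wpM2r// expRN ler_pdivrMr ?expR_gt0//.
  by move: (expR_ge1Dx (2 * x ^+ 2 / 3)); clear; lra.
have P1 : f x * ln (f x / approx v f x) <= 3 / 2 * M * (k0 + 2) * (W * U).
  have y20 : 0 <= (k0 + 2) * y2 by rewrite mulr_ge0// ?addr_ge0 ?(ltW k00)// sqr_ge0.
  apply: (@le_trans _ _ (f x * ((k0 + 2) * y2))); first by rewrite ler_wpM2l// ltW.
  apply: (@le_trans _ _ (M * expR (- x ^+ 2) * ((k0 + 2) * y2))); first by rewrite ler_wpM2r.
  have -> : M * expR (- x ^+ 2) * ((k0 + 2) * y2) =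
    M * (k0 + 2) * W * (x ^+ 2 * expR (- x ^+ 2)) by rewrite yW; ring.
  have c0 : 0 <= M * (k0 + 2) * W by rewrite mulr_ge0// ?(ltW Mk0)// (le_trans ler01 W1).
  by move: (ler_wpM2l c0 xU); clear; lra.
have P2 : approx v f x <= 8 * M * S0 * (W * U).
  rewrite ler_pdivrMr//; apply: le_trans (up x) _; rewrite -/S0 -/U.
  have MSU : 0 <= M * S0 * U by rewrite mulr_ge0// ltW.
  have h1 := ler_wpM2l MSU W1.
  have h2 : 0 <= M * S0 * (W * U) by rewrite !mulr_ge0// ?(ltW M0) ?(ltW S00)// (le_trans ler01 W1).
  by move: h1 (ler_wpM2l h2 ka); clear; lra.
(* Here the radius is used: [x ^ 2 / 4 >= 2 (r + 2) v ^ 2 >= (2 beta + 2) v ^ 2] pays for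
   [sigma ^ (2 beta)] and for [W = sigma ^ (- 2)], and [1 / 3 - 1 / 16 >= 1 / 4]. *)
have WU : W * U <= T * E.
  rewrite /W /U /T /E sig_powR /sig -expRM_natl -expRN -!expRD ler_expR.
  have R2 : (2 * r.+2%:R) * v ^+ 2 <= x ^+ 2 / 4.
    have : rad r v ^+ 2 <= x ^+ 2.
      by rewrite -x2 lerXn2r ?nnegrE ?(ltW xr)// (le_trans v0' rv).
    have r2 : 1 <= r.+2%:R :> R by rewrite (ler_nat R 1).
    have -> : rad r v ^+ 2 = 64 * r.+2%:R * (r.+2%:R * v ^+ 2) by rewrite /rad; ring.
    have rv0 : 0 <= r.+2%:R * v ^+ 2 by rewrite mulr_ge0 ?sqr_ge0.
    by move: rv0 (ler_wpM2l rv0 r2); clear; lra.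
  have B2 : (2 * beta + 2) * v ^+ 2 <= (2 * r.+2%:R) * v ^+ 2.
    rewrite ler_wpM2r ?sqr_ge0//; case/andP: rbr => _ br.
    have -> : r.+2%:R = r.+1%:R + 1 :> R by rewrite natr1.
    by move: br; clear; lra.
  by move: R2 B2 (sqr_ge0 x); clear; lra.
have fx := f0 x.
by rewrite /relent; move: P1 P2 fx (ler_wpM2l Kout0 WU); rewrite /Kout; clear; lra.
Qed.

End Pointwise.

(** * Integration *)

Section KullbackLeibler.
Variable R : realType.
Local Notation mu := (@lebesgue_measure R).
Implicit Types (f g h : R -> R) (sigma x : R).

Lemma integral_fin_integrable f c : measurable_fun setT f -> (forall x, 0 <= f x) ->
  (\int[mu]_(x in setT) (f x)%:E = c%:E)%E -> mu.-integrable setT (EFin \o f).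
Proof.
move=> mf f0 fc; apply/integrableP; split; first exact/measurable_EFinP.
have -> : (\int[mu]_x `|(EFin \o f) x| = c%:E)%E; last exact: ltry.
rewrite -fc; apply: eq_integral => x _ /=.
by rewrite ger0_norm.
Qed.

Lemma KL_le f g h Z B : prob_density f -> (forall x, 0 < f x) ->
  measurable_fun setT g -> (forall x, 0 < g x) -> 0 < Z ->
  (\int[mu]_(x in setT) (g x)%:E = Z%:E)%E ->
  mu.-integrable setT (EFin \o h) -> (\int[mu]_(x in setT) (h x)%:E = B%:E)%E ->
  (forall x, relent f g x <= h x) ->
  (KL f (fun x => Z^-1 * g x)%R <= B%:E)%E.
Proof.
move=> [mf [_ f1]] f0 mg g0 Z0 gZ ih hB Dh.
have if_ := integral_fin_integrable mf (fun x => ltW (f0 x)) f1.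
have ig := integral_fin_integrable mg (fun x => ltW (g0 x)) gZ.
have mlnf : measurable_fun setT (fun x => ln (f x)).
  by apply: measurableT_comp => //; exact: measurable_ln.
have mlng : measurable_fun setT (fun x => ln (g x)).
  by apply: measurableT_comp => //; exact: measurable_ln.
pose D x := f x * (ln (f x) - ln (g x)) + g x - f x.
have DE x : D x = relent f g x.
  by rewrite /D /relent ln_div ?posrE.
have mD : measurable_fun setT D.
  apply: measurable_funB => //; apply: measurable_funD => //.
  by apply: measurable_funM => //; exact: measurable_funB.
have D0 x : 0 <= D x.
  rewrite DE /relent; have fx := f0 x; have gx := g0 x.
  have : ln (g x / f x) <= g x / f x - 1.
    have -> : g x / f x = 1 + (g x / f x - 1) by lra.
    rewrite [leRHS](_ : _ = g x / f x - 1); last by lra.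
    by apply: le_ln1Dx; have := divr_gt0 gx fx; lra.
  rewrite !ln_div ?posrE// => /(ler_wpM2l (ltW fx)).
  have -> : f x * (g x / f x - 1) = g x - f x by field; rewrite gt_eqF.
  lra.
have iD : mu.-integrable setT (EFin \o D).
  apply: (le_integrable measurableT _ _ ih); first exact/measurable_EFinP.
  move=> x _ /=; rewrite lee_fin ger0_norm//.
  by apply: le_trans (ler_norm _); rewrite DE.
(* Splitting off the nonnegative integrable [D] leaves integrable terms whose integral is
   [1 + ln Z - Z]. *)
have KE : KL f (fun x => Z^-1 * g x)%R =
    (\int[mu]_x ((D x)%:E + ((1 + ln Z)%:E * (f x)%:E - (g x)%:E)))%E.
  apply: eq_integral => x _; rewrite -EFinM -EFinB -EFinD; congr EFin.
  rewrite /D ln_div ?posrE ?mulr_gt0 ?invr_gt0// lnM ?posrE ?invr_gt0// lnV ?posrE//.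
  by ring.
have if1 : mu.-integrable setT (fun x => (1 + ln Z)%:E * (f x)%:E)%E.
  exact: integrableZl.
rewrite KE integralD//; last exact: integrableB.
rewrite integralB// integralZl// f1 gZ mule1 -EFinB.
have DB : (\int[mu]_x (D x)%:E <= B%:E)%E.
  rewrite -hB; apply: ge0_le_integral => //.
  - by move=> x _; rewrite lee_fin.
  - exact/measurable_EFinP.
  - by case/integrableP : ih.
  - by move=> x _; rewrite lee_fin DE.
rewrite -[leRHS]adde0; apply: leeD => //; rewrite lee_fin.
have : ln Z <= Z - 1.
  have -> : Z = 1 + (Z - 1) by lra.
  rewrite [leRHS](_ : _ = Z - 1); last by lra.
  by apply: le_ln1Dx; lra.
lra.
Qed.

Lemma psi_s_normal sigma m x : 0 < sigma ->
  psi_s sigma (x - m) = normal_pdf m (sigma / Num.sqrt 2) x.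
Proof.
move=> s0; have q2 : 0 < Num.sqrt 2 :> R by rewrite sqrtr_gt0.
have sq : (sigma / Num.sqrt 2) ^+ 2 *+ 2 = sigma ^+ 2.
  by rewrite expr_div_n sqr_sqrtr// -[_ *+ 2]mulr_natr divfK.
rewrite normal_pdfE ?gt_eqF ?divr_gt0//= /normal_peak /normal_fun sq.
rewrite -mulrnAl sq sqrtrM ?sqr_ge0// sqrtr_sqr gtr0_norm// invfM /psi_s /psi.
by rewrite expr_div_n mulNr mulrA.
Qed.

Lemma integrable_psi_s sigma m : 0 < sigma ->
  mu.-integrable setT (fun x => (psi_s sigma (x - m))%:E).
Proof.
move=> s0; have := integrable_normal_pdf m (sigma / Num.sqrt 2).
by under [X in _ -> _.-integrable _ X]eq_fun do rewrite psi_s_normal//.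
Qed.

Lemma integral_psi_s sigma m : 0 < sigma ->
  (\int[mu]_(x in setT) (psi_s sigma (x - m))%:E = 1)%E.
Proof.
move=> s0; rewrite -(integral_normal_pdf m (sigma / Num.sqrt 2)).
by apply: eq_integral => x _; rewrite psi_s_normal.
Qed.

Lemma gmix_integral sigma (n : nat) (p m : 'I_n -> R) : 0 < sigma ->
  mu.-integrable setT (fun x => (gmix sigma p m x)%:E) /\
  (\int[mu]_(x in setT) (gmix sigma p m x)%:E = (\sum_(u < n) p u)%:E)%E.
Proof.
move=> s0.
have iu u : mu.-integrable setT (fun x => (p u)%:E * (psi_s sigma (x - m u))%:E)%E.
  by apply: integrableZl => //; exact: integrable_psi_s.
have E x : (gmix sigma p m x)%:E = (\sum_(u < n) ((p u)%:E * (psi_s sigma (x - m u))%:E))%E.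
  by rewrite /gmix -sumEFin.
split.
  under eq_fun do rewrite E.
  by apply: integrable_sum.
under eq_integral do rewrite E.
rewrite integral_sum// -sumEFin; apply: eq_bigr => u _.
rewrite integralZl ?integral_psi_s ?mule1//.
exact: integrable_psi_s.
Qed.

Lemma gauss16 : exists2 I : R, 0 < I & forall c : R,
  mu.-integrable setT (fun x => (c * expR (- (x ^+ 2 / 16)))%:E) /\
  (\int[mu]_(x in setT) (c * expR (- (x ^+ 2 / 16)))%:E = (c * I)%:E)%E.
Proof.
have q : 0 < Num.sqrt pi :> R by rewrite sqrtr_gt0 pi_gt0.
have s4 : 0 < 4 :> R by [].
exists (4 * Num.sqrt pi); first by rewrite mulr_gt0.
move=> c.
have E x : (c * expR (- (x ^+ 2 / 16)))%:E =
    ((c * (4 * Num.sqrt pi))%:E * (psi_s 4 (x - 0))%:E)%E.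
  rewrite -EFinM subr0 /psi_s /psi expr_div_n -natrX; congr EFin.
  by field; rewrite gt_eqF.
under eq_fun do rewrite E; split.
  by apply: integrableZl => //; exact: integrable_psi_s.
rewrite integralZl ?integral_psi_s ?mule1//.
exact: integrable_psi_s.
Qed.

End KullbackLeibler.

(** * The class H *)

Section Class.
Variable R : realType.
Implicit Types (f : R -> R) (b c x sigma : R).

Lemma rdeg_bounds b : 0 < b -> (rdeg b)%:R < b <= (rdeg b).+1%:R.
Proof.
move=> b0; have /andP[c1 c2] := ceil_itv b.
have c0 : 0 < Num.ceil b by rewrite ceil_gt0.
have E : ((rdeg b : nat) : int) = Num.ceil b - 1.
  by rewrite /rdeg gez0_abs// subr_ge0 -gtz0_ge1.
have ER : (rdeg b)%:R = (Num.ceil b - 1)%:~R :> R by rewrite -E.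
rewrite -natr1 ER c1/=; apply: le_trans c2 _.
by rewrite intrD rmorphN1 subrK.
Qed.

(** [C] sees [b] only through [r], which makes all later constants uniform between consecutive
    integers. *)
Lemma class_regular r gam lp (L : {poly R}) : 0 < gam -> 0 < lp ->
  exists2 C, 1 <= C & forall b eps Cm alpha xi M f, 0 < b -> rdeg b = r ->
    classH b gam lp L eps Cm alpha xi M f -> regular r gam b C (fun x => ln (f x)).
Proof.
move=> g0 l0; have [K K0 LK] := horner_growth L.
pose K' : R := r`!%:R * K; have K'0 : 0 <= K' by rewrite mulr_ge0.
pose C1 : R := lp + (1 + gam) * K' + K' + gam^-1.
have C10 : 0 <= C1.
  by rewrite /C1 !addr_ge0 ?invr_ge0 ?(ltW l0) ?(ltW g0)// mulr_ge0// addr_ge0// ltW.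
pose C2 : R := C1 + r%:R * (lp + 1).
have C20 : 0 <= C2 by rewrite /C2 addr_ge0// mulr_ge0// addr_ge0// ltW.
exists (C2 + K' + 1); first by lra.
move=> b eps Cm alpha xi M f b0 rb [_ [dr [hol [d0 _]]]].
have /andP[rb1 rb2] := rdeg_bounds b0; rewrite rb in dr hol d0 rb1 rb2.
have br : 0 < b - r%:R <= 1.
  by rewrite subr_gt0 rb1 lerBlDr addrC natr1.
have hol' x y : `|y - x| <= gam ->
    `|derive1n r (fun x => ln (f x)) x - derive1n r (fun x => ln (f x)) y| <=
    ew K' x * `|y - x| `^ (b - r%:R).
  move=> /hol/le_trans; apply; rewrite ler_wpM2r ?powR_ge0//.
  rewrite /ew /K' -mulrA ler_wpM2l//; apply: le_trans (ler_norm _) _.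
  apply: le_trans (LK x) _; rewrite /ew ler_wpM2l// ler_expR ler_wpM2r//.
  by rewrite ler_peMl// (ler_nat R 1) fact_gt0.
have top := top_derivative_growth g0 l0 K'0 br hol' (d0 r (leqnn r)).
have ders := derivatives_growth l0 C10 dr top d0.
split=> // [j x jr|x y xy].
  by apply: le_trans (ders j jr x) _; apply: le_ew => //; rewrite -/C2; lra.
apply: le_trans (hol' x y xy) _; rewrite ler_wpM2r ?powR_ge0//.
by apply: le_ew => //; lra.
Qed.

Definition mixture_exists b (G Gt c sigma : R) f :=
  exists (m : nat) (p mu : 'I_m -> R),
    (forall u, 0 <= p u) /\ \sum_(u < m) p u = 1 /\
    m%:R < G * sigma^-1 * `|ln sigma| `^ (3 / 2) /\
    (exists mus : R, mus <= Gt * `|ln sigma| `^ (1 / 2) /\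
       forall u, - mus <= mu u <= mus) /\
    (KL f (gmix sigma p mu) <= (c * sigma `^ (2 * b))%:E)%E.

Lemma mixture_exists_le b G G' Gt Gt' c c' sigma f : 0 < sigma -> G <= G' -> Gt <= Gt' ->
  c <= c' -> mixture_exists b G Gt c sigma f -> mixture_exists b G' Gt' c' sigma f.
Proof.
move=> s0 GG GGt cc [m [p [mu [p0 [p1 [mG [[mus [musG muu]] kl]]]]]]].
exists m, p, mu; split; first by [].
split; first by [].
split.
  apply: lt_le_trans mG _; apply: ler_wpM2r; first exact: powR_ge0.
  by apply: ler_wpM2r => //; rewrite invr_ge0 ltW.
split.
  by exists mus; split=> //; apply: le_trans musG _; rewrite ler_wpM2r ?powR_ge0.
by apply: le_trans kl _; rewrite lee_fin ler_wpM2r ?powR_ge0.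
Qed.

(** A range of order [v] at spacing of order [sigma / v ^ 2] gives order [v ^ 3 / sigma] nodes; with
    [v ^ 2 = |ln sigma|] this is the exponent 3/2. *)
Lemma half_le r (v : R) : 1 <= v ->
  (2 * half r v).+1%:R < (2 * (8 * r.+2%:R + 2) * (16 * r.+4%:R) + 2) * ((sig v)^-1 * v ^+ 3).
Proof.
move=> v1; have s0 := sig_gt0 v; have s1 := sig_le1 v.
have [_ h2] := half_bounds r v1; have [_ sb] := scl_bounds r v1.
have v0 : 0 <= v by lra.
have lE : lat R (scl r v) * (16 * (scl r v)%:R) = 1.
  by rewrite /lat mulVf// mulf_neq0 ?pnatr_eq0.
have A : (half r v)%:R * sig v <= (8 * r.+2%:R + 2) * (16 * r.+4%:R) * v ^+ 3.
  have -> : (half r v)%:R * sig v = (half r v)%:R * step r v * (16 * (scl r v)%:R).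
    have -> : (half r v)%:R * step r v * (16 * (scl r v)%:R) =
      (half r v)%:R * sig v * (lat R (scl r v) * (16 * (scl r v)%:R)) by rewrite /step; ring.
    by rewrite lE mulr1.
  have -> : (8 * r.+2%:R + 2) * (16 * r.+4%:R) * v ^+ 3 =
    ((8 * r.+2%:R + 2) * v) * (16 * (r.+4%:R * v ^+ 2)) by ring.
  apply: ler_pM => //.
  - by rewrite mulr_ge0 ?(ltW (step_gt0 r v)).
  - by apply: le_trans h2 _; rewrite /rad [leRHS]mulrDl lerD2l; lra.
  - by rewrite ler_wpM2l.
have v3 : 1 <= v ^+ 3 by rewrite exprn_ege1.
rewrite [_ * (_^-1 * _)]mulrCA mulrC ltr_pdivlMr//.
move: A; move: (half r v) => H A.
have -> : (2 * H).+1%:R = 2 * H%:R + 1 :> R by rewrite -natr1 natrM.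
lra.
Qed.

(** The order of quantifiers matters: [GG] must later increase with [b], so it may not deteriorate
    as [b] tends to 0 and is fixed before [b0]; the threshold and the divergence constant may depend
    on [b0]. *)
Lemma core r gam lp (L : {poly R}) xi M : 0 < gam -> 0 < lp -> 0 < xi -> 0 < M ->
  exists GG : R * R, [/\ 0 < GG.1, 0 < GG.2 & forall b0, 0 < b0 <= 1 ->
  exists sc : R * R, [/\ 0 < sc.1 < 1, 0 < sc.2 &
    forall b eps Cm alpha f, b0 <= b -> rdeg b = r -> 0 < alpha ->
      classH b gam lp L eps Cm alpha xi M f ->
      forall sigma, 0 < sigma < sc.1 -> mixture_exists b GG.1 GG.2 sc.2 sigma f]].
Proof.
move=> g0 l0 x0 M0; have [a [asum aP]] := stencil R r.
have [C C1 creg] := class_regular r L g0 l0.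
exists (2 * (8 * r.+2%:R + 2) * (16 * r.+4%:R) + 2, 8 * r.+2%:R + 2) => /=.
split; [by rewrite ltr_wpDl// !mulr_ge0// addr_ge0// mulr_ge0|by rewrite ltr_wpDl// mulr_ge0|].
move=> b0 b01; have [K [v0 [K0 v01 H]]] := pointwise asum aP g0 C1 b01 M0 x0.
have [I I0 gI] := gauss16 R.
exists (expR (- v0 ^+ 2), K * I + 1) => /=; split.
- rewrite expR_gt0 -[ltRHS]expR0 ltr_expR oppr_lt0 exprn_gt0//; lra.
- by rewrite ltr_wpDl// mulr_ge0// ltW.
move=> b eps Cm alpha f bb rb alpha0 cf sigma /andP[s0 ss].
have bpos : 0 < b by case/andP: b01 => ? _; lra.
have rbr := rdeg_bounds bpos; rewrite rb in rbr.
have reg := creg _ _ _ _ _ _ _ bpos rb cf.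
case: cf => [dens [_ [_ [_ [_ [_ [fM [f0 [_ [_ fxi]]]]]]]]]].
have xf : xi <= f 0 by apply: fxi; rewrite oppr_le0 ltW.
pose v : R := Num.sqrt (- ln sigma).
have lns : v0 ^+ 2 < - ln sigma.
  by rewrite ltrNr -[ltRHS]expRK ltr_ln ?posrE ?expR_gt0.
have lns0 : 0 <= - ln sigma by apply: le_trans (ltW lns); exact: sqr_ge0.
have vE : v ^+ 2 = - ln sigma by rewrite sqr_sqrtr.
have vv0 : v0 <= v.
  rewrite -(@ler_pXn2r _ 2)// ?nnegrE ?sqrtr_ge0//; last lra.
  by rewrite vE ltW.
have sE : sig v = sigma by rewrite /sig vE opprK lnK.
have v1 : 1 <= v by exact: le_trans vv0.
have v_0 : 0 <= v by lra.
have lnE : `|ln sigma| = v ^+ 2 by rewrite -normrN ger0_norm.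
have [fine wpos apos bound] := H v b f vv0 rbr bb reg f0 fM xf.
have /andP[ka _] := kap_bounds r v1.
have k0 : 0 < kap r v by apply: lt_le_trans ka; rewrite invr_gt0.
have q0 : 0 < Num.sqrt pi :> R by rewrite sqrtr_gt0 pi_gt0.
pose m := (2 * half r v).+1.
(* The factor [sigma sqrt pi] cancels the normalisation of [psi_s], so these weights reproduce
   [approx] exactly. *)
pose u (k : 'I_m) : R := lat R (scl r v) / kap r v * wt a v f (node r v k) * (sigma * Num.sqrt pi).
have u0 k : 0 < u k.
  by rewrite /u mulr_gt0 ?(mulr_gt0 s0)// mulr_gt0// divr_gt0// lat_scl_gt0.
pose Z := \sum_k u k.
have Z0 : 0 < Z.
  rewrite /Z big_ord_recl ltr_pwDl// sumr_ge0// => k _; exact/ltW/u0.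
have gE x : gmix sigma u (fun k : 'I_m => node r v k) x = approx a v f x.
  rewrite /gmix /approx /mixsum mulr_suml; apply: eq_bigr => k _.
  rewrite /psi_s /psi /u sE /gauss_fun.
  have -> : (x - node r v k) / sigma = - ((node r v k - x) / sigma) by ring.
  by rewrite sqrrN; field; rewrite !gt_eqF.
exists m, (fun k => u k / Z), (fun k => node r v k).
split; first by move=> k; rewrite divr_ge0// ltW.
split; first by rewrite -mulr_suml mulfV// gt_eqF.
split.
  have -> : `|ln sigma| `^ (3 / 2) = v ^+ 3.
    rewrite lnE -!powR_mulrn// -powRrM; congr powR; lra.
  by rewrite -sE -mulrA; exact: half_le.
split.
  exists (rad r v + 2); split.
    have -> : `|ln sigma| `^ (1 / 2) = v.
      by rewrite lnE -powR_mulrn// -powRrM mulrA mulr1 mulfV// powRr1.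
    by rewrite /rad [leRHS]mulrDl lerD2l; lra.
  by move=> k; rewrite -ler_norml; exact: node_bound.
have E : gmix sigma (fun k => u k / Z) (fun k : 'I_m => node r v k) =
    (fun x => Z^-1 * approx a v f x).
  apply/funext => x; rewrite -gE /gmix mulr_sumr; apply: eq_bigr => k _; ring.
have [ig intg] := gmix_integral u (fun k : 'I_m => node r v k) s0.
have gEf : gmix sigma u (fun k : 'I_m => node r v k) = approx a v f.
  by apply/funext => x; exact: gE.
rewrite gEf in ig intg.
have ma : measurable_fun setT (approx a v f).
  by apply/measurable_EFinP; case/integrableP: ig.
have [ih hI] := gI (K * sigma `^ (2 * b)).
rewrite E; apply: le_trans (KL_le dens f0 ma apos Z0 intg ih hI _) _.
  by move=> x; rewrite -sE; exact: bound.
have -> : (K * I + 1) * sigma `^ (2 * b) = K * sigma `^ (2 * b) * I + sigma `^ (2 * b) by ring.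
by rewrite lee_fin lerDl powR_ge0.
Qed.

End Class.

Theorem theorem2 (R : realType) (gam lp : R) (L : {poly R})
    (eps C alpha xi M : R) :
  0 < gam -> 0 < lp -> 0 < eps -> 0 < C -> 0 < alpha -> 0 < xi -> 0 < M ->
  exists (sigbar c G Gt : R -> R),
    (forall b, 0 < b -> 0 < sigbar b < 1) /\
    (forall b, 0 < b -> {for b, continuous sigbar}) /\
    (forall b, 0 < b -> 0 < c b) /\
    (forall b, 0 < b -> {for b, continuous c}) /\
    (forall b, 0 < b -> 0 < G b /\ 0 < Gt b) /\
    (forall b1 b2, 0 < b1 -> b1 < b2 -> G b1 < G b2 /\ Gt b1 < Gt b2) /\
    (forall (b : R) (f : R -> R), 0 < b ->
       classH b gam lp L eps C alpha xi M f ->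
       forall sigma, 0 < sigma < sigbar b ->
       exists (m : nat) (p mu : 'I_m -> R),
         (forall u, 0 <= p u) /\ \sum_(u < m) p u = 1 /\
         m%:R < G b * sigma^-1 * `|ln sigma| `^ (3 / 2) /\
         (exists mus : R, mus <= Gt b * `|ln sigma| `^ (1 / 2) /\
            forall u, - mus <= mu u <= mus) /\
         (KL f (gmix sigma p mu) <= (c b * sigma `^ (2 * b))%:E)%E).
Proof.
move=> gam0 lp0 _ _ alpha0 xi0 M0.
have /choice[GG HG] := fun r => core r L gam0 lp0 xi0 M0.
pose bn (n : nat) : R := n.+1%:R^-1.
have bn01 n : 0 < bn n <= 1.
  by rewrite /bn invr_gt0 ltr0n/= invf_le1 ?ltr0n// (ler_nat R 1).
have /choice[sc Hsc] : forall rn : nat * nat, exists s : R * R,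
    [/\ 0 < s.1 < 1, 0 < s.2 & forall b eps Cm alpha f, bn rn.2 <= b -> rdeg b = rn.1 ->
      0 < alpha -> classH b gam lp L eps Cm alpha xi M f -> forall sigma,
      0 < sigma < s.1 -> mixture_exists b (GG rn.1).1 (GG rn.1).2 s.2 sigma f].
  by move=> [r n]; have [_ _ H] := HG r; exact: H.
(* Summing over the square of indices up to [N] dominates each entry in it. Thresholds are inverted
   so that larger means more restrictive. *)
pose uS N := \sum_(r < N.+1) \sum_(n < N.+1) (sc (r : nat, n : nat)).1^-1.
pose uC N := \sum_(r < N.+1) \sum_(n < N.+1) (sc (r : nat, n : nat)).2.
have s0 rn : 0 < (sc rn).1 by have [/andP[]] := Hsc rn.
have c0 rn : 0 < (sc rn).2 by have [] := Hsc rn.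
have uS0 N : 0 <= uS N.
  by apply: sumr_ge0 => r _; apply: sumr_ge0 => n _; rewrite invr_ge0 ltW.
have uC0 N : 0 <= uC N.
  by apply: sumr_ge0 => r _; apply: sumr_ge0 => n _; rewrite ltW.
have uG0 r : 0 <= (GG r).1 by have [/ltW] := HG r.
have uGt0 r : 0 <= (GG r).2 by have [_ /ltW] := HG r.
(* Continuous, and large at both ends of [(0, oo)]: for [N = trunc (w b)], both [rdeg b <= N] and
   [1 / (N + 1) <= b] hold. *)
pose w (b : R) := b + b^-1.
have w0 b : 0 < b -> 0 < w b by move=> b0; rewrite addr_gt0 ?invr_gt0.
have cw b : 0 < b -> {for b, continuous w}.
  by move=> b0; apply: cvgD; [exact: cvg_id|apply: cvgV; [rewrite gt_eqF|exact: cvg_id]].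
have cenv u b : 0 < b -> {for b, continuous (envelope u \o w)}.
  by move=> b0; apply: continuous_comp; [exact: cw|apply: envelope_continuous; exact: w0].
pose sigbar b : R := (1 + (envelope uS \o w) b)^-1.
have eS b : 0 < b -> 0 < envelope uS (w b) by move=> b0; apply: envelope_gt0 => //; exact: w0.
(* [G] and [Gt] take the envelope in [b] itself, as they must increase; [w] decreases near 0 and
   serves only where continuity is required. *)
exists sigbar, (envelope uC \o w), (envelope (fun r => (GG r).1)), (envelope (fun r => (GG r).2)).
split.
  move=> b b0; have := eS b b0; rewrite /sigbar /= invr_gt0 => e0.
  by rewrite invf_lt1 ?ltrDl ?e0 ?andbT; lra.
split.
  move=> b b0; apply: cvgV; first by rewrite gt_eqF//= ltr_pwDl// ltW// eS.
  by apply: cvgD; [exact: cvg_cst|exact: cenv].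
split; first by move=> b b0 /=; apply: envelope_gt0 => //; exact: w0.
split; first by move=> b b0; exact: cenv.
split; first by move=> b b0; split; apply: envelope_gt0.
split; first by move=> b1 b2 b10 b12; split; apply: envelope_lt.
move=> b f b0 cf sigma /andP[sg0 sg1].
have /andP[rb1 rb2] := rdeg_bounds b0.
set r := rdeg b in rb1 rb2.
pose N := Num.trunc (w b).
have /andP[N1 N2] := truncn_itv (ltW (w0 b b0)); rewrite -/N in N1 N2.
have iv0 : 0 < b^-1 by rewrite invr_gt0.
have rN : (r < N.+1)%N by rewrite -(ltr_nat R); apply: lt_trans rb1 _; rewrite /w in N2; lra.
have [_ _ H] := Hsc (r, N).
have bN : bn N <= b.
  by rewrite /bn invf_ple ?posrE ?ltr0n//; apply/ltW; rewrite /w in N2; lra.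
have env u : (forall n, 0 <= u n) -> u N <= envelope u (w b).
  by move=> u0; apply: envelope_ge => //; exact: w0.
have envr (u : nat -> R) : (forall n, 0 <= u n) -> u r <= envelope u b.
  by move=> u0; apply: envelope_ge => //; exact: ltW.
have sumle (g : nat -> nat -> R) : (forall i j, 0 <= g i j) ->
    g r N <= \sum_(i < N.+1) \sum_(j < N.+1) g i j.
  move=> g0; rewrite (bigD1 (Ordinal rN))//= (bigD1 ord_max)//= -addrA lerDl addr_ge0//.
    by apply: sumr_ge0.
  by apply: sumr_ge0 => i _; exact: sumr_ge0.
apply: (@mixture_exists_le R b (GG r).1 _ (GG r).2 _ (sc (r, N)).2 _ sigma f sg0).
- exact: (envr (fun r => (GG r).1)).
- exact: (envr (fun r => (GG r).2)).
- apply: le_trans (env uC uC0); apply: (sumle (fun r n => (sc (r, n)).2)) => i j.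
  exact: ltW.
apply: (H b eps C alpha f bN _ alpha0 cf) => //; rewrite sg0/=.
apply: lt_le_trans sg1 _; rewrite /sigbar /= -[leRHS]invrK lef_pV2 ?posrE ?invr_gt0//.
  apply: le_trans (_ : uS N <= _).
    apply: (sumle (fun r n => (sc (r, n)).1^-1)) => i j; rewrite invr_ge0; exact: ltW.
  by apply: le_trans (env uS uS0) _; rewrite lerDr.
by rewrite ltr_pwDl// ltW// eS.
Qed.
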